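(* Let $K$ be an infinite field, let $\mathbf{Vec}$ be the category of finite-dimensional vector spaces over $K$, let $P:\mathbf{Vec}\to\mathbf{Vec}$ be a finite-degree polynomial functor, and equip $P_\infty:=\varprojlim_n P(K^n)$ with the inverse-limit topology of the Zariski topologies on the $P(K^n)$. Then $P_\infty$ is $\mathrm{GL}_\infty$-Noetherian, i.e., every chain $P_\infty\supseteq Y_1\supseteq Y_2\supseteq\cdots$ of $\mathrm{GL}_\infty$-stable closed subsets of $P_\infty$ is eventually constant. Equivalently, every $\mathrm{GL}_\infty$-stable closed subset $Y$ of $P_\infty$ is the set of common zeroes of finitely many $\mathrm{GL}_\infty$-orbits of polynomial equations.
   Context: A finite-degree polynomial functor $P:\mathbf{Vec}\to\mathbf{Vec}$ is a covariant functor for which there is a uniform bound $d$ such that for all $V,W\in\mathbf{Vec}$ the map $P:\operatorname{Hom}(V,W)\to\operatorname{Hom}(P(V),P(W))$ is polynomial of degree at most $d$. The projective limit $P_\infty$ is taken along the linear maps $P(\pi_n):P(K^{n+1})\to P(K^n)$, where $\pi_n:K^{n+1}\to K^n$ forgets the last coordinate. The group $\mathrm{GL}_n=\mathrm{GL}_n(K)$ acts on $P(K^n)$ by functoriality, and $\mathrm{GL}_n$ is embedded in $\mathrm{GL}_{n+1}$ via $g\mapsto\operatorname{diag}(g,1)$; the maps $P(\pi_n)$ are $\mathrm{GL}_n$-equivariant, so that $\mathrm{GL}_\infty:=\bigcup_n\mathrm{GL}_n$ acts on $P_\infty$. A polynomial equation on $P_\infty$ is given by an element of the direct limit over $n$ of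 the coordinate rings $K[P(K^n)]$, i.e. a polynomial function on some $P(K^n)$ composed with the projection $P_\infty\to P(K^n)$; $\mathrm{GL}_\infty$ acts on these functions by the induced action. *)

(* Defs.v *)
(* Only the canonical structures of multinomials are
   imported, because its notations clash with those of the analysis library. *)
From HB Require Import structures.
From mathcomp Require Import all_boot all_order all_algebra.
From mathcomp Require Import all_classical topology.
From mathcomp Require Import (canonicals, coercions) mpoly.

Set Implicit Arguments.
Unset Strict Implicit.
Unset Printing Implicit Defensive.

Import GRing.Theory.
Local Open Scope classical_set_scope.
Local Open Scope ring_scope.

(* Polynomial functions are expressed in coordinates with respect to a chosen
   basis; neither the notion nor the degree bound depends on the basis. *)
Definition coordinates (K : fieldType) (V : vectType K) (v : V) :
    'I_(\dim {:V}) -> K :=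
  fun i => coord (vbasis {:V}) i v.

Definition polynomial_function (K : fieldType) (V : vectType K) (f : V -> K) :
    Prop :=
  exists p : mpoly.mpoly (\dim {:V}) K,
    forall v, f v = mpoly.meval (coordinates v) p.

(* [msize p] is one more than the total degree of [p], and 0 if [p] = 0. *)
Definition polynomial_map_le (K : fieldType) (d : nat) (U W : vectType K)
    (f : U -> W) : Prop :=
  forall j : 'I_(\dim {:W}), exists p : mpoly.mpoly (\dim {:U}) K,
    (mpoly.msize p <= d.+1)%N /\
    forall u, coordinates (f u) j = mpoly.meval (coordinates u) p.

Record vec_functor (K : fieldType) : Type := VecFunctor {
  fobj :> vectType K -> vectType K;
  fmor : forall V W : vectType K, 'Hom(V, W) -> 'Hom(fobj V, fobj W);
  fmor_id : forall V : vectType K, fmor (\1%VF : 'Hom(V, V)) = \1%VF;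
  fmor_comp : forall (U V W : vectType K) (f : 'Hom(V, W)) (g : 'Hom(U, V)),
    fmor (f \o g)%VF = (fmor f \o fmor g)%VF
}.

Definition finite_degree_polynomial (K : fieldType) (P : vec_functor K) :
    Prop :=
  exists d : nat, forall V W : vectType K,
    polynomial_map_le d (@fmor K P V W).

Definition zariski (K : fieldType) (V : vectType K) : Type := V.

Section Zariski.
Variables (K : fieldType) (V : vectType K).

Definition zero_locus (S : set (V -> K)) : set V :=
  [set v | forall f, S f -> f v = 0].

Definition zariski_closed (A : set V) : Prop :=
  exists2 S : set (V -> K), S `<=` @polynomial_function K V & A = zero_locus S.

Definition zariski_open : set_system (zariski V) :=
  [set U | zariski_closed (~` U)].

Lemma zariski_openT : zariski_open setT.
Proof.
exists [set cst 1].
  by move=> _ ->; exists 1 => v; rewrite mpoly.meval1.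
rewrite setCT; apply/seteqP; split=> // v /(_ _ erefl) /eqP.
by rewrite /cst oner_eq0.
Qed.

Lemma zariski_openI : setI_closed zariski_open.
Proof.
move=> A B [S Spoly AE] [T Tpoly BE].
exists [set fg | exists f g, [/\ S f, T g & fg = fun v => f v * g v]].
  move=> _ [f [g [/Spoly [p fE] /Tpoly [q gE] ->]]].
  by exists (p * q) => v; rewrite mpoly.mevalM fE gE.
rewrite setCI AE BE; apply/seteqP; split=> [v [v0|v0] _ [f [g [Sf Tg ->]]]|v v0].
- by rewrite v0 ?mul0r.
- by rewrite (v0 g) ?mulr0.
apply/or_asboolP; rewrite -[_ || _]negbK negb_or.
apply/negP => /andP[/asboolPn/existsNP[f /not_implyP[Sf /eqP f0]]].
move=> /asboolPn/existsNP[g /not_implyP[Tg /eqP g0]].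
have /eqP := v0 _ (ex_intro _ f (ex_intro _ g (And3 Sf Tg erefl))).
by rewrite mulf_eq0 (negPf f0) (negPf g0).
Qed.

Lemma zariski_open_bigU (I : Type) (U : I -> set (zariski V)) :
  (forall i, zariski_open (U i)) -> zariski_open (\bigcup_i U i).
Proof.
move=> Uo.
exists [set f | polynomial_function f /\
                exists i, forall v, (~` U i) v -> f v = 0].
  by move=> f [].
rewrite setC_bigcup; apply/seteqP; split=> [v Uv f [_ [i]]|v v0 i _].
  by apply; exact: Uv.
have [S Spoly UE] := Uo i.
rewrite UE => f Sf; apply: v0; split; first exact: Spoly.
by exists i => w; rewrite UE; apply.
Qed.

HB.instance Definition _ := Choice.on (zariski V).
HB.instance Definition _ := isOpenTopological.Build (zariski V)
  zariski_openT zariski_openI zariski_open_bigU.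

Lemma closed_zariskiE (A : set (zariski V)) : closed A <-> zariski_closed A.
Proof. by rewrite -openC -[X in _ <-> zariski_closed X]setCK. Qed.

End Zariski.

Section InverseLimit.
Variables (K : fieldType) (P : vec_functor K).

(* The space K^n is realised as the column vectors, on which matrices act from
   the left. *)
Definition truncate (m n : nat) (le_mn : (m <= n)%N) :
    'Hom('cV[K]_n, 'cV[K]_m) :=
  linfun (rowsub (widen_ord le_mn)).

Definition forget_last (n : nat) : 'Hom('cV[K]_n.+1, 'cV[K]_n) :=
  truncate (leqnSn n).

Definition mx_hom (n : nat) (g : 'M[K]_n) : 'Hom('cV[K]_n, 'cV[K]_n) :=
  linfun (mulmx g).

Definition compatible_sequences :
    set (prod_topology (fun n : nat => zariski (P 'cV[K]_n))) :=
  [set x | forall n, fmor P (forget_last n) (x n.+1) = x n].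

(* As a [set_type] of a [prod_topology], this carries the subspace topology of
   the product topology, which is the inverse-limit topology. *)
Definition P_infty : Type := set_type compatible_sequences.
HB.instance Definition _ := Topological.on P_infty.

Definition component (n : nat) (x : P_infty) : P 'cV[K]_n := set_val x n.

Lemma truncateE m n (le_mn : (m <= n)%N) v i :
  truncate le_mn v i 0 = v (widen_ord le_mn i) 0.
Proof. by rewrite lfunE mxE. Qed.

Lemma truncate_id n (le_nn : (n <= n)%N) : truncate le_nn = \1%VF.
Proof.
apply/lfunP => v; rewrite id_lfunE; apply/colP => i.
by rewrite truncateE; congr (v _ _); apply: val_inj.
Qed.

Lemma truncate_comp m n p (le_mn : (m <= n)%N) (le_np : (n <= p)%N)
    (le_mp : (m <= p)%N) :
  (truncate le_mn \o truncate le_np)%VF = truncate le_mp.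
Proof.
apply/lfunP => v; rewrite comp_lfunE; apply/colP => i.
by rewrite !truncateE; congr (v _ _); apply: val_inj.
Qed.

Lemma component_truncate m n (le_mn : (m <= n)%N) x :
  fmor P (truncate le_mn) (component n x) = component m x.
Proof.
elim: n le_mn => [|n IHn] le_mn.
  move: le_mn; have [->|m_gt0] := posnP m; last by move: m_gt0; case: m.
  by move=> le00; rewrite truncate_id fmor_id id_lfunE.
have [ltmn|] := leqP m n; last first.
  move=> ltnm; move: (le_mn); have -> : m = n.+1 by apply/eqP; rewrite eqn_leq le_mn.
  by move=> le; rewrite truncate_id fmor_id id_lfunE.
rewrite -(truncate_comp ltmn (leqnSn n)) fmor_comp comp_lfunE -(IHn ltmn).
by congr (fmor P _ _); exact: (set_mem (valP x) n).
Qed.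

Lemma mx_homE n (g : 'M[K]_n) v : mx_hom g v = g *m v.
Proof. by rewrite lfunE. Qed.

(* The block matrix is diag(g, 1) in GL_(n + m). Acting by it on the component
   of index n + m and then truncating avoids a case distinction between m <= n
   and n <= m; see [GL_act_extend] for the defining property of the action. *)
Definition GL_act_fun (n : nat) (g : 'M[K]_n) (x : P_infty) (m : nat) :
    P 'cV[K]_m :=
  fmor P (truncate (leq_addl n m))
    (fmor P (mx_hom (block_mx g 0 0 1%:M)) (component (n + m) x)).

Lemma truncate_equivariant n m p (le_mp : (n + m <= n + p)%N) (g : 'M[K]_n) :
  (truncate le_mp \o mx_hom (block_mx g 0 0 1%:M))%VF =
  (mx_hom (block_mx g 0 0 1%:M) \o truncate le_mp)%VF.
Proof.
apply/lfunP => v; rewrite !comp_lfunE !mx_homE.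
have le_mp' : (m <= p)%N by rewrite leq_add2l in le_mp.
have truncE (w : 'cV_(n + p)) : truncate le_mp w =
    col_mx (usubmx w) (rowsub (widen_ord le_mp') (dsubmx w)).
  apply/colP => i; rewrite truncateE mxE; case: splitP => j ij.
    by rewrite mxE; congr (w _ _); apply: val_inj.
  by rewrite !mxE; congr (w _ _); apply: val_inj.
rewrite !truncE -[v in LHS]vsubmxK !mul_block_col !mul0mx !mul1mx !addr0 !add0r.
by rewrite col_mxKu col_mxKd.
Qed.

Lemma GL_act_level n (g : 'M[K]_n) x k m p (le_mp : (m <= p)%N)
    (le_km : (k <= n + m)%N) (le_kp : (k <= n + p)%N) :
  fmor P (truncate le_km)
    (fmor P (mx_hom (block_mx g 0 0 1%:M)) (component (n + m) x)) =
  fmor P (truncate le_kp)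
    (fmor P (mx_hom (block_mx g 0 0 1%:M)) (component (n + p) x)).
Proof.
have le_nmp : (n + m <= n + p)%N by rewrite leq_add2l.
rewrite -(component_truncate le_nmp) -(truncate_comp le_km le_nmp).
rewrite -[fmor P (mx_hom _) (fmor P _ _)]comp_lfunE -fmor_comp.
rewrite -truncate_equivariant [in RHS]fmor_comp [in RHS]comp_lfunE.
by rewrite [in LHS]fmor_comp [in LHS]comp_lfunE.
Qed.

Lemma GL_act_compatible n (g : 'M[K]_n) x :
  compatible_sequences (GL_act_fun g x).
Proof.
move=> m; rewrite /GL_act_fun -comp_lfunE -fmor_comp.
have le_m : (m <= n + m.+1)%N by rewrite addnS leqW ?leq_addl.
by rewrite (truncate_comp _ _ le_m) -(GL_act_level g x (leqnSn m) (leq_addl n m)).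
Qed.

Definition GL_act (n : nat) (g : 'M[K]_n) (x : P_infty) : P_infty :=
  exist _ (GL_act_fun g x : prod_topology _) (mem_set (GL_act_compatible g x)).

Lemma GL_act_extend n m (g : 'M[K]_n) x :
  component (n + m) (GL_act g x) =
  fmor P (mx_hom (block_mx g 0 0 1%:M)) (component (n + m) x).
Proof.
rewrite [LHS](_ : _ = GL_act_fun g x (n + m)) ?/component ?set_valE //.
rewrite /GL_act_fun -(GL_act_level g x (leq_addl n m) (leqnn (n + m))).
by rewrite truncate_id fmor_id id_lfunE.
Qed.

Definition GL_stable (Y : set P_infty) : Prop :=
  forall (n : nat) (g : 'M[K]_n), g \in unitmx ->
  forall x, Y x -> Y (GL_act g x).

Definition GL_noetherian : Prop :=
  forall Y : nat -> set P_infty,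
    (forall i, closed (Y i)) ->
    (forall i, GL_stable (Y i)) ->
    (forall i, Y i.+1 `<=` Y i) ->
    exists N : nat, forall i, (N <= i)%N -> Y i = Y N.

(* Over an infinite field the coordinate ring of P(K^n) is its ring of
   polynomial functions, and the direct limit of these rings is the ring of
   their pullbacks to the inverse limit: every projection to a component is
   surjective, since the truncations are split by extension by zero. *)
Definition polynomial_equation (F : P_infty -> K) : Prop :=
  exists n : nat, exists2 f : P 'cV[K]_n -> K,
    polynomial_function f & F = f \o component n.

Definition GL_act_equation (n : nat) (g : 'M[K]_n) (F : P_infty -> K) :
    P_infty -> K :=
  F \o GL_act (invmx g).

Definition GL_orbit (F : P_infty -> K) : set (P_infty -> K) :=
  [set F' | exists n : nat, exists2 g : 'M[K]_n,
              g \in unitmx & F' = GL_act_equation g F].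

Definition common_zeroes (S : set (P_infty -> K)) : set P_infty :=
  [set x | forall F, S F -> F x = 0].

End InverseLimit.

(* Main.v *)
(* Following Draisma, coordinates are chosen and a well-founded order on
   polynomial functors is used: the degree, then the dimension of the top-degree
   part at [K^d]. Let [R] be a simple subfunctor of the top-degree part of [P];
   the functors [P / R] and [(shift of P) / R] are smaller than [P].

   For a closed [X] in [P] with image in [C], a closed subset of [P / R], either
   [X] is the full preimage of [C] or some polynomial [f] vanishes on [X] but not
   on that preimage. The lowest nonzero part [h] of the Taylor expansion of [f]
   along [R] has smaller degree than [f], so by induction the locus of [X] where
   the [GL]-translates of [h] vanish is Noetherian. Where [h] is nonzero, varying
   the argument of [f] along linear maps shows that a point of [X] is determined
   by its image in [(shift of P) / R], through a linear system for its coordinate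
   in [R], and closed subsets of that quotient control those of [X].

   In positive characteristic the lowest part is additive, hence semilinear for a
   power endomorphism [sigma] of [K] (a power of Frobenius), and the linear system
   determines the [sigma]-twist of the coordinate. Its solvability needs the
   [sigma]-twist of [R] to be simple; this is arranged by first replacing [P] by
   one of its twists, so that neither perfectness of [K] nor any field extension
   is required. *)

Require Import Defs.
From HB Require Import structures.
From mathcomp Require Import all_boot all_order all_algebra.
From mathcomp Require Import all_classical topology.
From mathcomp Require Import (canonicals, coercions) mpoly.
Set Implicit Arguments.
Unset Strict Implicit.
Unset Printing Implicit Defensive.

Import GRing.Theory.
Local Open Scope classical_set_scope.
Local Open Scope ring_scope.

(** * Well-foundedness of strict orders *)

(** Noetherianity is phrased as well-foundedness of strict inclusion because the step is an
    induction on closed sets, and accessibility transfers along monotone maps that jointly reflect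
    the order. The notion used inside the induction is stability under all matrices of all shapes;
    [GL]-stable subsets of the limit reach it because invertible matrices are Zariski dense over an
    infinite field, so that the closures of their level images are stable under every matrix. The
    main obstacle is that only $K$-points are available, with no irreducible components and no
    localisation at [h]. Closed sets are therefore compared one point and one test function at a
    time: the test function is multiplied by a power of a determinant that equals 1 at the point
    considered, and so becomes a polynomial on the quotient. Measuring the top-degree part at $K^d$
    loses nothing, since degree [d] functions on diagonal matrices are controlled by those of rank
    at most [d]. *)

Definition strict T (le : T -> T -> Prop) (x y : T) : Prop := le x y /\ ~ le y x.

Lemma strict_pullback T A (leT : T -> T -> Prop) (leA : A -> A -> Prop)
    (phi : T -> A) :
  (forall x y, leT x y -> leA (phi x) (phi y)) ->
  (forall x y, leT x y -> leA (phi y) (phi x) -> leT y x) ->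
  well_founded (strict leA) -> well_founded (strict leT).
Proof.
move=> mono refl wfA x; have [a ax] : exists a, phi x = a by exists (phi x).
elim: a / (wfA a) x ax => a _ IH x ax; constructor=> y [yx nxy].
apply: (IH (phi y)) => //; rewrite -ax; split; first exact: mono.
by move=> /(refl _ _ yx).
Qed.

(** A strict descent in [T] must be strict under [phi] or under [psi], for otherwise [refl] would
    reverse it; so two nested accessibility inductions suffice. The predicate [S] confines the
    reflection property to the elements below a fixed one. *)
Lemma Acc_strict_prod T A B (leT : T -> T -> Prop) (leA : A -> A -> Prop)
    (leB : B -> B -> Prop) (phi : T -> A) (psi : T -> B) (S : T -> Prop) :
  (forall x, leA x x) -> (forall x, leB x x) ->
  (forall x y z, leA x y -> leA y z -> leA x z) ->
  (forall x y z, leB x y -> leB y z -> leB x z) ->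
  (forall x y, S x -> leT y x -> S y) ->
  (forall x y, leT x y -> leA (phi x) (phi y)) ->
  (forall x y, leT x y -> leB (psi x) (psi y)) ->
  (forall x y, S x -> leT y x -> leA (phi x) (phi y) -> leB (psi x) (psi y) ->
    leT x y) ->
  forall a, Acc (strict leA) a -> forall b, Acc (strict leB) b ->
  forall x, S x -> leA (phi x) a -> leB (psi x) b -> Acc (strict leT) x.
Proof.
move=> rfA rfB trA trB Sdown monoA monoB refl a accA.
elim: a / accA => a _ IHa b accB.
elim: b / accB => b accB IHb x Sx xa xb.
constructor=> y [yx nxy]; have Sy := Sdown _ _ Sx yx.
have ya := trA _ _ _ (monoA _ _ yx) xa; have yb := trB _ _ _ (monoB _ _ yx) xb.
have [ay|nay] := pselect (leA a (phi y)); last first.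
  by apply: (IHa (phi y) _ b) => //; constructor.
have [by_|nby] := pselect (leB b (psi y)).
  case: nxy; apply: refl => //; first exact: trA xa ay.
  exact: trB xb by_.
exact: (IHb (psi y)).
Qed.

Lemma strict_chain_stable T (le : T -> T -> Prop) (Y : nat -> T) :
  (forall x, le x x) -> (forall x y z, le x y -> le y z -> le x z) ->
  well_founded (strict le) -> (forall i, le (Y i.+1) (Y i)) ->
  exists N : nat, forall i, (N <= i)%N -> le (Y N) (Y i).
Proof.
move=> rf tr wf Ydec.
have [a ax] : exists a, Y 0%N = a by exists (Y 0%N).
elim: a / (wf a) Y Ydec ax => a _ IH Y Ydec Y0.
have leY i j : le (Y (i + j)%N) (Y i).
  by elim: j => [|j IHj]; rewrite ?addn0 // addnS; apply: tr (Ydec _) IHj.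
have [stable|/existsNP[i Yi]] := pselect (forall i, le (Y 0%N) (Y i)).
  by exists 0%N.
have lt_i : strict le (Y i) a by rewrite -Y0; split=> //; exact: (leY 0%N).
have [j||N NP] := IH _ lt_i (fun j => Y (i + j)%N); rewrite /= ?addn0 ?addnS //.
exists (i + N)%N => j ij; have := NP (j - i)%N; rewrite subnKC.
  by apply; rewrite leq_subRL // (leq_trans _ ij) ?leq_addr.
by rewrite (leq_trans _ ij) ?leq_addr.
Qed.

(** * Polynomial functions over an infinite field *)

Section PolynomialFunctions.
Variable K : fieldType.

(* Polynomials are taken as functions; over an infinite field nothing is lost. *)
Inductive polf (V : lmodType K) : nat -> (V -> K) -> Prop :=
| polf_cst k c : polf k (fun=> c)
| polf_lin k l : (forall a u v, l (a *: u + v) = a * l u + l v) -> polf k.+1 l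
| polf_add k f g : polf k f -> polf k g -> polf k (fun x => f x + g x)
| polf_mul j k f g : polf j f -> polf k g -> polf (j + k) (fun x => f x * g x).

Definition ispol (V : lmodType K) (f : V -> K) := exists k, polf k f.

Section Closure.
Variable V : lmodType K.
Implicit Types f g : V -> K.

Lemma eq_polf k f g : f =1 g -> polf k f -> polf k g.
Proof. by move=> /funext ->. Qed.

Lemma polf_le j k f : (j <= k)%N -> polf j f -> polf k f.
Proof.
move=> le_jk pf; elim: pf k le_jk => {j f}
  [j c|j l lin|j f g _ IHf _ IHg|i j f g _ IHf _ IHg] k le_jk.
- exact: polf_cst.
- by case: k le_jk => // k _; exact: polf_lin.
- by apply: polf_add; [exact: IHf|exact: IHg].
have le_ik : (i <= k)%N by rewrite (leq_trans _ le_jk) ?leq_addr.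
by rewrite -(subnKC le_ik); apply: polf_mul; [exact: IHf|apply: IHg; rewrite leq_subRL].
Qed.

Lemma polfZ k c f : polf k f -> polf k (fun x => c * f x).
Proof. by move=> pf; rewrite -[k]add0n; apply: polf_mul pf; exact: polf_cst. Qed.

Lemma polf_sum k (I : Type) (r : seq I) (F : I -> V -> K) :
  (forall i, polf k (F i)) -> polf k (fun x => \sum_(i <- r) F i x).
Proof.
move=> pF; elim: r => [|i r IH].
  by apply: eq_polf (polf_cst _ _ 0) => x; rewrite big_nil.
by apply: eq_polf (polf_add (pF i) IH) => x; rewrite big_cons.
Qed.

Lemma ispol_cst c : ispol (fun _ : V => c).
Proof. by exists 0%N; exact: polf_cst. Qed.

Lemma eq_ispol f g : f =1 g -> ispol f -> ispol g.
Proof. by move=> /funext ->. Qed.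

Lemma ispolD f g : ispol f -> ispol g -> ispol (fun x => f x + g x).
Proof.
move=> [j pf] [k pg]; exists (j + k)%N; apply: polf_add.
  by apply: polf_le pf; rewrite leq_addr.
by apply: polf_le pg; rewrite leq_addl.
Qed.

Lemma ispolM f g : ispol f -> ispol g -> ispol (fun x => f x * g x).
Proof. by move=> [j pf] [k pg]; exists (j + k)%N; exact: polf_mul. Qed.

Lemma ispolZ c f : ispol f -> ispol (fun x => c * f x).
Proof. by move=> pf; apply: ispolM => //; exact: ispol_cst. Qed.

Lemma ispolN f : ispol f -> ispol (fun x => - f x).
Proof. by move=> /(ispolZ (-1)); apply: eq_ispol => x; rewrite mulN1r. Qed.

Lemma ispolX f n : ispol f -> ispol (fun x => f x ^+ n).
Proof.
move=> pf; elim: n => [|n IH]; first exact: ispol_cst.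
by apply: eq_ispol (ispolM pf IH) => x; rewrite exprS.
Qed.

Lemma ispol_sum (I : Type) (r : seq I) (F : I -> V -> K) :
  (forall i, ispol (F i)) -> ispol (fun x => \sum_(i <- r) F i x).
Proof.
move=> pF; elim: r => [|i r IH].
  by apply: eq_ispol (ispol_cst 0) => x; rewrite big_nil.
by apply: eq_ispol (ispolD (pF i) IH) => x; rewrite big_cons.
Qed.

Lemma ispol_prod (I : Type) (r : seq I) (F : I -> V -> K) :
  (forall i, ispol (F i)) -> ispol (fun x => \prod_(i <- r) F i x).
Proof.
move=> pF; elim: r => [|i r IH].
  by apply: eq_ispol (ispol_cst 1) => x; rewrite big_nil.
by apply: eq_ispol (ispolM (pF i) IH) => x; rewrite big_cons.
Qed.

Lemma ispol_det n (M : V -> 'M[K]_n) :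
  (forall i j, ispol (fun x => M x i j)) -> ispol (fun x => \det (M x)).
Proof. by move=> pM; apply: ispol_sum => s; apply/ispolZ/ispol_prod. Qed.

Lemma ispol_adj n (M : V -> 'M[K]_n) i j :
  (forall i j, ispol (fun x => M x i j)) -> ispol (fun x => \adj (M x) i j).
Proof.
move=> pM; apply: (@eq_ispol (fun x => cofactor (M x) j i)).
  by move=> x; rewrite mxE.
apply/ispolZ/ispol_det => a b.
by apply: eq_ispol (pM (lift j a) (lift i b)) => x; rewrite !mxE.
Qed.

Lemma ispol_mulmx m n p (A : V -> 'M[K]_(m, n)) (B : V -> 'M[K]_(n, p)) i j :
  (forall i j, ispol (fun x => A x i j)) ->
  (forall i j, ispol (fun x => B x i j)) ->
  ispol (fun x => (A x *m B x) i j).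
Proof.
move=> pA pB; apply: (@eq_ispol (fun x => \sum_k A x i k * B x k j)).
  by move=> x; rewrite mxE.
by apply: ispol_sum => k; exact: ispolM.
Qed.

End Closure.

Lemma polf_affine (U V : lmodType K) k (f : V -> K) (c : V) (L : U -> V) :
  (forall a u v, L (a *: u + v) = a *: L u + L v) ->
  polf k f -> polf k (fun x => f (c + L x)).
Proof.
move=> linL; elim=> {k f} [k a|k l lin|k f g _ IHf _ IHg|j k f g _ IHf _ IHg].
- exact: polf_cst.
- have lD u v : l (u + v) = l u + l v by rewrite -[u]scale1r lin mul1r scale1r.
  apply: (@eq_polf _ _ (fun x => l c + l (L x))) => [x|]; first by rewrite lD.
  apply: polf_add; first exact: polf_cst.
  by apply: polf_lin => a u v; rewrite linL lin.
- exact: polf_add.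
- exact: polf_mul.
Qed.

Lemma polf_comp (U V : lmodType K) k (f : V -> K) (L : U -> V) :
  (forall a u v, L (a *: u + v) = a *: L u + L v) ->
  polf k f -> polf k (fun x => f (L x)).
Proof.
by move=> linL /(polf_affine 0 linL); apply: eq_polf => x; rewrite add0r.
Qed.

Lemma polf_mulmxr m n p k (f : 'M[K]_(m, p) -> K) (B : 'M[K]_(n, p)) :
  polf k f -> polf k (fun x => f (x *m B)).
Proof. by apply: polf_comp => a u v; rewrite mulmxDl scalemxAl. Qed.

Lemma polf_entry m n i j : polf 1 (fun A : 'M[K]_(m, n) => A i j).
Proof. by apply: polf_lin => a u v; rewrite !mxE. Qed.

Lemma polf_mulmx2 a m n b k (V : lmodType K) (M : V -> 'M[K]_(m, n))
    (A : 'M[K]_(a, m)) (B : 'M[K]_(n, b)) i j :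
  (forall i j, polf k (fun x => M x i j)) ->
  polf k (fun x => (A *m M x *m B) i j).
Proof.
move=> pM.
apply: (@eq_polf _ _ (fun x => \sum_q \sum_p (A i p * B q j) * M x p q)).
  move=> x; rewrite mxE; apply: eq_bigr => q _; rewrite mxE mulr_suml.
  by apply: eq_bigr => p _; rewrite mulrAC.
by apply: polf_sum => q; apply: polf_sum => p; exact: polfZ.
Qed.

Definition pcurve (V : lmodType K) (y : K -> V) : Prop :=
  forall l : V -> K, (forall a u v, l (a *: u + v) = a * l u + l v) ->
  exists q : {poly K}, forall t, l (y t) = q.[t].

Lemma polf_pcurve (V : lmodType K) k (f : V -> K) (y : K -> V) :
  pcurve y -> polf k f -> exists q : {poly K}, forall t, f (y t) = q.[t].
Proof.
move=> py; elim=> {k f} [k a|k l lin|k f g _ IHf _ IHg|j k f g _ IHf _ IHg].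
- by exists a%:P => t; rewrite hornerC.
- exact: py.
- by have [[p pE] [q qE]] := (IHf, IHg); exists (p + q) => t; rewrite hornerD pE qE.
- by have [[p pE] [q qE]] := (IHf, IHg); exists (p * q) => t; rewrite hornerM pE qE.
Qed.

Lemma pcurve_line (V : lmodType K) (u v : V) : pcurve (fun t => u + t *: v).
Proof.
move=> l lin; exists ((l u)%:P + l v *: 'X) => t.
by rewrite addrC lin !hornerE /= mulrC addrC.
Qed.

Lemma pcurve_rowM n p (x : 'rV[K]_n) (M : K -> 'M[K]_(n, p)) :
  (forall i j, exists q : {poly K}, forall t, M t i j = q.[t]) ->
  pcurve (fun t => x *m M t).
Proof.
move=> pM l lin; have lD u v : l (u + v) = l u + l v.
  by rewrite -[u]scale1r lin mul1r scale1r.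
have l0 : l 0 = 0 by apply: (addrI (l 0)); rewrite -lD !addr0.
have [q qE] := choice (fun ij => pM ij.1 ij.2).
exists (\sum_i \sum_j (x 0 i * l (delta_mx 0 j)) *: q (i, j)) => t.
have -> : x *m M t = \sum_j \sum_i (x 0 i * M t i j) *: delta_mx 0 j.
  rewrite [LHS]row_sum_delta; apply: eq_bigr => j _.
  by rewrite mxE scaler_suml.
have lsum I (r : seq I) F : l (\sum_(i <- r) F i) = \sum_(i <- r) l (F i).
  by elim/big_rec2: _ => // i _ y _ <-; rewrite lD.
rewrite lsum (eq_bigr (fun j => \sum_i l ((x 0 i * M t i j) *: delta_mx 0 j))).
  rewrite exchange_big horner_sum; apply: eq_bigr => i _.
  rewrite horner_sum; apply: eq_bigr => j _.
  by rewrite -[_ *: delta_mx _ _]addr0 lin l0 addr0 hornerZ -qE /= mulrAC.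
by move=> j _; rewrite lsum.
Qed.

End PolynomialFunctions.

(** * Taylor expansion, homogeneous parts and finite differences *)

Section InfiniteField.
Variable K : fieldType.
Hypothesis K_infinite : infinite_set [set: K].

Lemma poly_fun0_inj (g : K -> K) (q : {poly K}) :
  injective g -> (forall t, q.[g t] = 0) -> q = 0.
Proof.
move=> g_inj q0; apply/eqP; apply: contrapT => /negP qn0.
have [B _ Bsize] := infinite_set_fset (size q) K_infinite.
have := max_poly_roots qn0 (_ : all (root q) (map g (finmap.enum_fset B))).
rewrite map_inj_uniq // ltnNge size_map Bsize => /(_ _ (finmap.fset_uniq B))/negP.
by apply=> //; apply/allP => _ /mapP[x _ ->]; apply/rootP.
Qed.

Lemma poly_fun0 (q : {poly K}) : (forall t, q.[t] = 0) -> q = 0.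
Proof. by apply: poly_fun0_inj. Qed.

Lemma poly_fun_inj (p q : {poly K}) : (forall t, p.[t] = q.[t]) -> p = q.
Proof.
move=> pq; apply/eqP; rewrite -subr_eq0; apply/eqP/poly_fun0 => t.
by rewrite hornerD hornerN pq subrr.
Qed.

(** The bound [k - i] on the coefficient of order [i] is what makes the lowest Taylor part a
    function of smaller degree than [f]. *)
Lemma taylor_exists (V : lmodType K) k (f : V -> K) : polf k f ->
  exists q : V -> V -> {poly K},
    [/\ forall x s, (size (q x s) <= k.+1)%N,
        forall i s, polf (k - i) (fun x => (q x s)`_i) &
        forall x s t, f (x + t *: s) = (q x s).[t]].
Proof.
elim=> {k f} [k a|k l lin|k f g _ [p [p1 p2 p3]] _ [q [q1 q2 q3]]
  |j k f g _ [p [p1 p2 p3]] _ [q [q1 q2 q3]]].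
- exists (fun _ _ => a%:P); split=> [x s|i s|x s t]; last by rewrite hornerC.
    by rewrite (leq_trans (size_polyC_leq1 _)).
  exact: polf_cst.
- exists (fun x s => (l x)%:P + (l s)%:P * 'X); split=> [x s|i s|x s t].
  + rewrite (leq_trans (size_polyD _ _)) // geq_max.
    rewrite (leq_trans (size_polyC_leq1 _)) //=.
    by rewrite (leq_trans (size_polyMleq _ _)) // size_polyX addn2 /= ltnS
      (leq_trans (size_polyC_leq1 _)).
  + case: i => [|i].
      apply: (@eq_polf _ _ _ l); last exact: polf_lin.
      by move=> x; rewrite coefD coefC coefMX /= addr0.
    apply: (@eq_polf _ _ _ (fun=> ((l s)%:P * 'X)`_i.+1)); last exact: polf_cst.
    by move=> x; rewrite coefD coefC /= add0r.
  + by rewrite addrC lin !hornerE /= mulrC addrC.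
- exists (fun x s => p x s + q x s); split=> [x s|i s|x s t].
  + by rewrite (leq_trans (size_polyD _ _)) // geq_max p1 q1.
  + by apply: eq_polf (polf_add (p2 i s) (q2 i s)) => x; rewrite coefD.
  + by rewrite p3 q3 hornerD.
- exists (fun x s => p x s * q x s); split=> [x s|i s|x s t].
  + rewrite (leq_trans (size_polyMleq _ _)) //.
    have := leq_add (p1 x s) (q1 x s); rewrite addnS addSn.
    by case: (_ + _)%N.
  + apply: (@eq_polf _ _ _ (fun x => \sum_(a < i.+1) (p x s)`_a * (q x s)`_(i - a))).
      by move=> x; rewrite coefM.
    apply: polf_sum => a.
    (* Truncated subtraction is harmless: a factor vanishes when its index exceeds its degree, and
       in the remaining case [(j - a) + (k - (i - a))] is exactly [j + k - i]. *)
    have [lt_ja|le_aj] := ltnP j a.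
      apply: (@eq_polf _ _ _ (fun=> 0)); last exact: polf_cst.
      by move=> x; rewrite nth_default ?mul0r // (leq_trans (p1 _ _)).
    have [lt_k|le_k] := ltnP k (i - a).
      apply: (@eq_polf _ _ _ (fun=> 0)); last exact: polf_cst.
      by move=> x; rewrite [X in _ * X]nth_default ?mulr0 // (leq_trans (q1 _ _)).
    apply: polf_le (polf_mul (p2 a s) (q2 (i - a)%N s)).
    have ia : (a + (i - a))%N = i by rewrite subnKC // -ltnS.
    by rewrite -[X in (_ + _ - X)%N]ia subnDA -addnBAC // -addnBA.
  + by rewrite p3 q3 hornerM.
Qed.

(** Picked by choice, with default 0 when no polynomial exists; over an infinite field it is unique,
    so identities of functions of [t] become identities of coefficients. *)
Definition taylor (V : lmodType K) (f : V -> K) (x s : V) : {poly K} :=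
  xget 0 [set q : {poly K} | forall t, f (x + t *: s) = q.[t]].

Section Taylor.
Variables (V : lmodType K) (k : nat) (f : V -> K).
Hypothesis pf : polf k f.
Implicit Types x s : V.

Lemma taylorE x s t : f (x + t *: s) = (taylor f x s).[t].
Proof.
have [q [_ _ qE]] := taylor_exists pf.
exact: (@xgetPex _ 0 [set q : {poly K} | forall t, f (x + t *: s) = q.[t]]
  (ex_intro _ (q x s) (qE x s))).
Qed.

Lemma taylor_unique x s q : (forall t, f (x + t *: s) = q.[t]) -> taylor f x s = q.
Proof. by move=> qE; apply: poly_fun_inj => t; rewrite -qE -taylorE. Qed.

Lemma size_taylor x s : (size (taylor f x s) <= k.+1)%N.
Proof.
by have [q [q1 _ qE]] := taylor_exists pf; rewrite (taylor_unique (qE x s)).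
Qed.

Lemma polf_taylor i s : polf (k - i) (fun x => (taylor f x s)`_i).
Proof.
have [q [_ q2 qE]] := taylor_exists pf.
by apply: eq_polf (q2 i s) => x; rewrite (taylor_unique (qE x s)).
Qed.

Lemma taylor0 x s : (taylor f x s)`_0 = f x.
Proof. by rewrite -horner_coef0 -taylorE scale0r addr0. Qed.

Lemma taylorZ x s a i : (taylor f x (a *: s))`_i = a ^+ i * (taylor f x s)`_i.
Proof.
have -> : taylor f x (a *: s) = taylor f x s \Po (a *: 'X).
  apply: taylor_unique => t; rewrite scalerA taylorE horner_comp.
  by rewrite !hornerE /= mulrC.
rewrite comp_polyE coef_sum.
have sz : (size (taylor f x s) <= (maxn (size (taylor f x s)) i.+1))%N by rewrite leq_maxl.
rewrite (big_ord_widen _ (fun j => ((taylor f x s)`_j *: (a *: 'X) ^+ j)`_i) sz) /=.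
rewrite big_mkcond /= (bigD1 (Ordinal (leq_maxr (size (taylor f x s)) i.+1))) //=.
rewrite big1 ?addr0.
  rewrite exprZn !coefZ coefXn eqxx mulr1; case: ltnP => [_|/leq_sizeP/(_ i)->//].
    by rewrite mulrC.
  by rewrite mulr0.
move=> j /negPf ji; case: ifP => // _; rewrite exprZn !coefZ coefXn.
have -> : (i == j :> nat) = false; last by rewrite !mulr0.
by rewrite eq_sym -ji.
Qed.

End Taylor.

Lemma polf0_cst (V : lmodType K) (f : V -> K) x y : polf 0 f -> f x = f y.
Proof.
move=> pf; have fE z : f z = f 0.
  have := taylorE pf 0 z 1; rewrite scale1r add0r => ->.
  have /size1_polyC -> := size_taylor pf 0 z.
  by rewrite hornerC (taylor0 pf).
by rewrite (fE x) (fE y).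
Qed.

Lemma polf_homog (V : lmodType K) k (f : V -> K) : polf k f ->
  exists q : V -> {poly K},
    [/\ forall x, (size (q x) <= k.+1)%N, forall i, polf i (fun x => (q x)`_i) &
        forall x t, f (t *: x) = (q x).[t]].
Proof.
elim=> {k f} [k a|k l lin|k f g _ [p [p1 p2 p3]] _ [q [q1 q2 q3]]
  |j k f g _ [p [p1 p2 p3]] _ [q [q1 q2 q3]]].
- exists (fun _ => a%:P); split=> [x|i|x t]; last by rewrite hornerC.
    by rewrite (leq_trans (size_polyC_leq1 _)).
  exact: polf_cst.
- exists (fun x => (l x)%:P * 'X); split=> [x|i|x t].
  + by rewrite (leq_trans (size_polyMleq _ _)) // size_polyX addn2 /= ltnS
      (leq_trans (size_polyC_leq1 _)).
  + case: i => [|i].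
      by apply: (@eq_polf _ _ _ (fun=> 0)) (polf_cst _ _ _) => x; rewrite coefMX.
    case: i => [|i].
      by apply: (@eq_polf _ _ _ l) (polf_lin _ lin) => x; rewrite coefMX coefC.
    by apply: (@eq_polf _ _ _ (fun=> 0)) (polf_cst _ _ _) => x; rewrite coefMX coefC.
  + have l0 : l 0 = 0.
      have := lin 1 0 0; rewrite scale1r addr0 mul1r => /eqP.
      by rewrite -subr_eq0 opprD addrA subrr sub0r oppr_eq0 => /eqP.
    by rewrite -[t *: x]addr0 lin l0 addr0 !hornerE mulrC.
- exists (fun x => p x + q x); split=> [x|i|x t].
  + by rewrite (leq_trans (size_polyD _ _)) // geq_max p1 q1.
  + by apply: eq_polf (polf_add (p2 i) (q2 i)) => x; rewrite coefD.
  + by rewrite p3 q3 hornerD.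
- exists (fun x => p x * q x); split=> [x|i|x t].
  + rewrite (leq_trans (size_polyMleq _ _)) //.
    have := leq_add (p1 x) (q1 x); rewrite addnS addSn.
    by case: (_ + _)%N.
  + apply: (@eq_polf _ _ _ (fun x => \sum_(a < i.+1) (p x)`_a * (q x)`_(i - a))).
      by move=> x; rewrite coefM.
    apply: polf_sum => a; apply: polf_le (polf_mul (p2 a) (q2 (i - a)%N)).
    by rewrite subnKC // -ltnS ltn_ord.
  + by rewrite p3 q3 hornerM.
Qed.

(** At [t = 1] the decomposition into homogeneous parts recovers [f], and the hypothesis says that
    the part of degree [k.+1] is zero. *)
Lemma polf_drop_degree (V : lmodType K) k (f : V -> K) : polf k.+1 f ->
  (forall x, exists2 q : {poly K}, (size q <= k.+1)%N & forall t, f (t *: x) = q.[t]) ->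
  polf k f.
Proof.
move=> /polf_homog[q [q1 q2 q3]] small.
apply: (@eq_polf _ _ _ (fun x => \sum_(i < k.+1) (q x)`_i)); last first.
  by apply: polf_sum => i; apply: polf_le (q2 i); rewrite -ltnS.
move=> x; rewrite -[x in RHS]scale1r q3.
have [p p1 pE] := small x.
have -> : q x = p by apply: poly_fun_inj => t; rewrite -q3 pE.
by rewrite (horner_coef_wide _ p1); apply: eq_bigr => i _; rewrite expr1n mulr1.
Qed.

(** The difference [f (y + v) - f y] has smaller degree. Taking more than [k] differences gives
    zero, so the value at the full sum is determined by the values at proper subsums. *)
Lemma polf_subsums (V : lmodType K) k (f : V -> K) (vs : seq V) x :
  polf k f -> (k < size vs)%N ->
  (forall b : bitseq, size b = size vs -> ~~ all id b ->
    f (x + \sum_(v <- mask b vs) v) = 0) ->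
  f (x + \sum_(v <- vs) v) = 0.
Proof.
elim: k f vs x => [|k IH] f [|v vs] x pf // sz f0.
  have := f0 (nseq (size (v :: vs)) false); rewrite size_nseq => /(_ erefl erefl).
  by move=> fx; rewrite -fx; exact: polf0_cst.
pose g y := (taylor f y v).[1] - f y.
have gE y : g y = f (y + v) - f y by rewrite /g -(taylorE pf) scale1r.
have pg : polf k g.
  apply: (@eq_polf _ _ _ (fun y => \sum_(i < k.+1) (taylor f y v)`_i.+1)).
    move=> y; rewrite /g (horner_coef_wide _ (size_taylor pf y v)) [in RHS]big_ord_recl.
    rewrite expr1n mulr1 (taylor0 pf) addrC addKr.
    by apply: eq_bigr => i _; rewrite expr1n mulr1.
  apply: polf_sum => i; apply: polf_le (polf_taylor pf _ _).
  by rewrite subSS leq_subr.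
have : g (x + \sum_(v <- vs) v) = 0.
  apply: IH pg _ _ => // b bsz nb.
  have := f0 (true :: b); have := f0 (false :: b); rewrite /= bsz nb.
  move=> /(_ erefl erefl) f1 /(_ erefl erefl); rewrite big_cons => f2.
  by rewrite gE f1 subr0 -addrA [_ + v]addrC.
rewrite gE big_cons [v + _]addrC addrA => /eqP; rewrite subr_eq0 => /eqP ->.
have := f0 (false :: nseq (size vs) true); rewrite /= size_nseq mask_true //.
by apply.
Qed.

End InfiniteField.

(** * Twisting coefficients by a field endomorphism *)

Section Twist.
Variable K : fieldType.
Hypothesis K_infinite : infinite_set [set: K].
Implicit Types sigma : {rmorphism K -> K}.

Lemma scalar_rowE m n (l : 'M[K]_(m, n) -> K) x :
  (forall a u v, l (a *: u + v) = a * l u + l v) ->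
  l x = \sum_i \sum_j x i j * l (delta_mx i j).
Proof.
move=> lin; have lD u v : l (u + v) = l u + l v.
  by rewrite -[u]scale1r lin mul1r scale1r.
have l0 : l 0 = 0 by apply: (addrI (l 0)); rewrite -lD !addr0.
have lsum I (r : seq I) F : l (\sum_(i <- r) F i) = \sum_(i <- r) l (F i).
  by elim/big_rec2: _ => // i _ y _ <-; rewrite lD.
rewrite {1}[x]matrix_sum_delta lsum; apply: eq_bigr => i _.
by rewrite lsum; apply: eq_bigr => j _; rewrite -[_ *: _]addr0 lin l0 addr0.
Qed.

(** The function [g] is [f] with [sigma] applied to its coefficients. *)
Lemma polf_twist sigma m n k (f : 'M[K]_(m, n) -> K) : polf k f ->
  exists2 g, polf k g & forall x, g (map_mx sigma x) = sigma (f x).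
Proof.
elim=> {k f} [k a|k l lin|k f g _ [f' pf fE] _ [g' pg gE]
  |j k f g _ [f' pf fE] _ [g' pg gE]].
- by exists (fun=> sigma a); first exact: polf_cst.
- exists (fun x : 'M_(m, n) => \sum_i \sum_j x i j * sigma (l (delta_mx i j))) => [|x].
    apply: polf_lin => a u v; rewrite mulr_sumr -big_split; apply: eq_bigr => i _.
    rewrite mulr_sumr -big_split; apply: eq_bigr => j _ /=.
    by rewrite !mxE mulrDl mulrA.
  rewrite (scalar_rowE x lin) rmorph_sum; apply: eq_bigr => i _.
  by rewrite rmorph_sum; apply: eq_bigr => j _; rewrite mxE rmorphM.
- exists (fun x => f' x + g' x); first exact: polf_add.
  by move=> x; rewrite fE gE rmorphD.
- exists (fun x => f' x * g' x); first exact: polf_mul.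
  by move=> x; rewrite fE gE rmorphM.
Qed.

Lemma polf_dense_seq (g : K -> K) (V : lmodType K) k (f : V -> K)
    (I : eqType) (r : seq I) (v : I -> V) :
  injective g -> polf k f -> uniq r ->
  (forall a : I -> K, f (\sum_(i <- r) g (a i) *: v i) = 0) ->
  forall a : I -> K, f (\sum_(i <- r) a i *: v i) = 0.
Proof.
move=> g_inj; elim: r f => [|i r IH] f pf /= => [_ f0 a|/andP[ir ur] f0 a].
  by have := f0 a; rewrite !big_nil.
rewrite big_cons; set w := \sum_(i <- r) _.
suff t0 : taylor f w (v i) = 0 by rewrite addrC (taylorE pf) t0 horner0.
apply: (poly_fun0_inj K_infinite g_inj) => t.
rewrite -(taylorE pf) addrC.
have ph : polf k (fun x => f (g t *: v i + x)).
  exact: (@polf_affine K V V k f (g t *: v i) id (fun _ _ _ => erefl) pf).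
apply: (IH _ ph ur) => b.
have := f0 (fun j => if j == i then t else b j).
rewrite big_cons eqxx; congr (f (_ + _) = 0).
rewrite [LHS]big_seq_cond [RHS]big_seq_cond; apply: eq_bigr => j; rewrite andbT.
by case: eqP => // ->; rewrite (negPf ir).
Qed.

(** An endomorphism is injective, so its image is infinite and the points with coordinates in it are
    Zariski dense, even when [sigma] is not onto. This density takes the place of perfectness of
    [K]. *)
Lemma polf_dense sigma m n k (f : 'M[K]_(m, n) -> K) : polf k f ->
  (forall x, f (map_mx sigma x) = 0) -> forall x, f x = 0.
Proof.
move=> pf f0 x; rewrite [x]matrix_sum_delta pair_big /=.
apply: (polf_dense_seq (fmorph_inj sigma) pf (index_enum_uniq _)
  (v := fun p => delta_mx p.1 p.2) _ (fun p => x p.1 p.2)) => a.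
rewrite -(f0 (\matrix_(i, j) a (i, j))); congr f.
rewrite [RHS]matrix_sum_delta pair_big /=; apply: eq_bigr => -[i j] _ /=.
by rewrite !mxE.
Qed.

(** Additivity alone makes the power map a field endomorphism, so no case distinction on the
    characteristic arises: [m] is then 1 or a power of the characteristic. *)
Lemma pow_rmorph m : (0 < m)%N ->
  (forall a b : K, (a + b) ^+ m = a ^+ m + b ^+ m) ->
  exists sigma, forall a, sigma a = a ^+ m.
Proof.
move=> m0 mD; pose f (a : K) := a ^+ m.
have f0 : f 0 = 0 by rewrite /f expr0n; case: m m0 {mD f}.
have fB : zmod_morphism f.
  move=> a b; apply/eqP; rewrite eq_sym subr_eq; apply/eqP.
  by rewrite /f -mD subrK.
have fM : monoid_morphism f by split; [exact: expr1n|move=> a b; exact: exprMn].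
pose A := GRing.isZmodMorphism.Build _ _ f fB.
pose M := GRing.isMonoidMorphism.Build _ _ f fM.
pose F : {rmorphism K -> K} := HB.pack f A M.
by exists F.
Qed.

End Twist.

(** * Polynomial substitutions and denominators *)

Section Substitution.
Variable K : fieldType.

Lemma ispol_comp_row (Z : lmodType K) n k (g : 'rV[K]_n -> K) (y : Z -> 'rV[K]_n) :
  polf k g -> (forall j, ispol (fun z => y z 0 j)) -> ispol (fun z => g (y z)).
Proof.
move=> pg py; elim: pg => {k g} [k a|k l lin|k f g _ pf _ pg|j k f g _ pf _ pg].
- exact: ispol_cst.
- apply: (@eq_ispol _ _ (fun z => \sum_i \sum_j y z i j * l (delta_mx i j))).
    by move=> z; rewrite -scalar_rowE.
  apply: ispol_sum => i; apply: ispol_sum => j; rewrite ord1.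
  by apply: ispolM; [exact: py|exact: ispol_cst].
- exact: ispolD.
- exact: ispolM.
Qed.

(* Clearing the denominator [D] in [g (a + (T / D) *m L)]. *)
Lemma polf_clear_denominator (Z : lmodType K) n r k (g : 'rV[K]_n -> K)
    (a : Z -> 'rV[K]_n) (T : Z -> 'rV[K]_r) (D : Z -> K) (L : 'M[K]_(r, n)) :
  polf k g -> (forall j, ispol (fun z => a z 0 j)) ->
  (forall j, ispol (fun z => T z 0 j)) -> ispol D ->
  exists2 G, ispol G &
    forall z w, D z *: w = T z -> D z ^+ k * g (a z + w *m L) = G z.
Proof.
move=> pg pa pT pD.
elim: pg => {k g} [k c|k l lin|k f g _ [F pF FE] _ [G pG GE]|j k f g _ [F pF FE] _ [G pG GE]].
- exists (fun z => D z ^+ k * c) => //.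
  by apply: ispolM; [exact: ispolX|exact: ispol_cst].
- exists (fun z => D z ^+ k * (D z * l (a z) + l (T z *m L))).
    apply/ispolM/ispolD; first exact: ispolX.
      by apply: ispolM => //; apply: (ispol_comp_row (k := 1)) => //; exact: polf_lin.
    apply: (ispol_comp_row (k := 1) (g := fun u => l (u *m L))) => //.
    by apply: polf_mulmxr; exact: polf_lin.
  move=> z w <-; have lD u v : l (u + v) = l u + l v.
    by rewrite -[u]scale1r lin mul1r scale1r.
  have l0 : l 0 = 0 by apply: (addrI (l 0)); rewrite -lD !addr0.
  rewrite -scalemxAl -[D z *: _]addr0 lin l0 addr0 -mulrDr -lD.
  by rewrite exprSr mulrA.
- exists (fun z => F z + G z); first exact: ispolD.
  by move=> z w E; rewrite -(FE _ _ E) -(GE _ _ E) mulrDr.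
- exists (fun z => F z * G z); first exact: ispolM.
  by move=> z w E; rewrite -(FE _ _ E) -(GE _ _ E) exprD mulrACA.
Qed.

(** Compared with [polf_pcurve], the coefficients in [t] are now polynomial in the starting point
    [y], as needed for a linear system that varies with [y]. *)
Lemma polf_row_curve n p k (f : 'rV[K]_p -> K) (M : K -> 'M[K]_(n, p)) :
  polf k f ->
  (forall i j, exists q : {poly K}, forall t, M t i j = q.[t]) ->
  exists2 q : 'rV[K]_n -> {poly K},
    forall i, ispol (fun y => (q y)`_i) & forall y t, f (y *m M t) = (q y).[t].
Proof.
move=> pf pM; have [M' M'E] := choice (fun ij => pM ij.1 ij.2).
elim: pf => {k f} [k a|k l lin|k f g _ [F pF FE] _ [G pG GE]|j k f g _ [F pF FE] _ [G pG GE]].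
- exists (fun=> a%:P) => [i|y t]; [exact: ispol_cst|by rewrite hornerC].
- exists (fun y => \sum_j \sum_i (y 0 i * l (delta_mx 0 j)) *: M' (i, j)) => [a|y t].
    apply: (@eq_ispol _ _
      (fun y : 'rV_n => \sum_j \sum_i y 0 i * (l (delta_mx 0 j) * (M' (i, j))`_a))).
      move=> y; rewrite coef_sum; apply: eq_bigr => j _.
      by rewrite coef_sum; apply: eq_bigr => i _; rewrite coefZ mulrA.
    apply: ispol_sum => j; apply: ispol_sum => i; apply: ispolM.
      by exists 1%N; exact: polf_entry.
    exact: ispol_cst.
  rewrite (scalar_rowE _ lin) big_ord1 horner_sum; apply: eq_bigr => j _.
  rewrite horner_sum mxE mulr_suml; apply: eq_bigr => i _.
  by rewrite hornerZ -M'E mulrAC.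
- exists (fun y => F y + G y) => [i|y t].
    by apply: eq_ispol (ispolD (pF i) (pG i)) => y; rewrite coefD.
  by rewrite hornerD FE GE.
- exists (fun y => F y * G y) => [i|y t].
    apply: (@eq_ispol _ _ (fun y => \sum_(a < i.+1) (F y)`_a * (G y)`_(i - a))).
      by move=> y; rewrite coefM.
    by apply: ispol_sum => a; exact: ispolM.
  by rewrite hornerM FE GE.
Qed.

End Substitution.

Section ZariskiClosure.
Variable K : fieldType.

Definition cl (V : lmodType K) (Z : set V) : set V :=
  [set x | forall k f, polf k f -> (forall z, Z z -> f z = 0) -> f x = 0].

Lemma sub_cl (V : lmodType K) (Z : set V) : Z `<=` cl Z.
Proof. by move=> x Zx k f pf; apply. Qed.

Lemma cl_comp (U V : lmodType K) (L : U -> V) (Z : set U) (Z' : set V) :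
  (forall a u v, L (a *: u + v) = a *: L u + L v) ->
  (forall z, Z z -> cl Z' (L z)) -> forall x, cl Z x -> cl Z' (L x).
Proof.
move=> linL sub x clx k f pf f0.
apply: (clx k (fun u => f (L u))); first exact: polf_comp.
by move=> z Zz; exact: sub pf f0.
Qed.

Lemma cl_min (V : lmodType K) (Z Z' : set V) : Z `<=` cl Z' -> cl Z `<=` cl Z'.
Proof. by move=> sub x; apply: (cl_comp (L := id)). Qed.

Lemma cl_mono (V : lmodType K) (Z Z' : set V) : Z `<=` Z' -> cl Z `<=` cl Z'.
Proof. by move=> sub; apply: cl_min => x /sub; exact: sub_cl. Qed.

Lemma cl_idem (V : lmodType K) (Z : set V) : cl (cl Z) `<=` cl Z.
Proof. exact: cl_min. Qed.

End ZariskiClosure.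

(** * Hilbert's basis theorem *)

Section HilbertBasis.

Record ideal (A : comNzRingType) := Ideal {
  in_ideal :> A -> Prop;
  ideal0 : in_ideal 0;
  idealD : forall x y, in_ideal x -> in_ideal y -> in_ideal (x + y);
  idealM : forall a x, in_ideal x -> in_ideal (a * x)
}.

(* Larger ideals come first, so that well-foundedness is the ascending chain
   condition. *)
Definition ideal_le (A : comNzRingType) (I J : ideal A) : Prop := forall x, J x -> I x.

Definition noetherian_ring (A : comNzRingType) : Prop :=
  well_founded (strict (@ideal_le A)).

Lemma noetherian_field (K : fieldType) : noetherian_ring K.
Proof.
have top (I : ideal K) x : I x -> x != 0 -> forall y, I y.
  by move=> Ix xn0 y; rewrite -[y](divfK xn0); exact: idealM.
suff accI (I : ideal K) x : I x -> x != 0 -> Acc (strict (@ideal_le K)) I.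
  move=> I; constructor=> J [_ /existsNP[x /not_implyP[Jx nIx]]].
  apply: (accI _ x Jx); apply: contra_notN nIx => /eqP ->; exact: ideal0.
by move=> Ix xn0; constructor=> J [_ []] y _; exact: top Ix xn0 y.
Qed.

Variable A : comNzRingType.
Implicit Types I J : ideal {poly A}.

Lemma idealB (B : comNzRingType) (I : ideal B) x y : I x -> I y -> I (x - y).
Proof. by move=> Ix Iy; apply: idealD => //; rewrite -mulN1r; exact: idealM. Qed.

(** Bounding the size instead of fixing it admits 0 and cancellation, so that the coefficients in
    degree [k] form an ideal. *)
Program Definition lead_ideal k I : ideal A := @Ideal A
  (fun a => exists p : {poly A}, [/\ I p, (size p <= k.+1)%N & p`_k = a]) _ _ _.
Next Obligation.
by move=> k I; exists 0; rewrite size_poly0 coef0; split=> //; exact: ideal0.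
Qed.
Next Obligation.
move=> k I _ _ [p [Ip sp <-]] [q [Iq sq <-]]; exists (p + q).
rewrite coefD (leq_trans (size_polyD _ _)) ?geq_max ?sp ?sq //.
by split=> //; exact: idealD.
Qed.
Next Obligation.
move=> k I a _ [p [Ip sp <-]]; exists (a%:P * p).
split; [exact: idealM| |by rewrite coefCM].
by rewrite mul_polyC (leq_trans (size_scale_leq _ _)).
Qed.

Lemma lead_ideal_succ k I a : lead_ideal k I a -> lead_ideal k.+1 I a.
Proof.
move=> [p [Ip sp <-]]; exists ('X * p); split; first exact: idealM.
  by rewrite (leq_trans (size_polyMleq _ _)) // size_polyX.
by rewrite coefXM.
Qed.

Lemma lead_ideal_leq j k I a : (j <= k)%N -> lead_ideal j I a -> lead_ideal k I a.
Proof.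
move=> /subnK <-; elim: (k - j)%N => //= i IH /IH; rewrite addSn.
exact: lead_ideal_succ.
Qed.

Program Definition lead_ideals I : ideal A := @Ideal A
  (fun a => exists k, lead_ideal k I a) _ _ _.
Next Obligation. by move=> I; exists 0%N; exact: (ideal0 (lead_ideal 0 I)). Qed.
Next Obligation.
move=> I x y [j Ix] [k Iy]; exists (maxn j k).
exact: idealD (lead_ideal_leq (leq_maxl j k) Ix) (lead_ideal_leq (leq_maxr j k) Iy).
Qed.
Next Obligation. by move=> I a x [k Ix]; exists k; exact: (idealM a Ix). Qed.

Lemma lead_ideal_sub k I J :
  ideal_le J I -> ideal_le (lead_ideal k J) (lead_ideal k I).
Proof. by move=> IJ a [p [/IJ Jp sp pk]]; exists p. Qed.

Lemma lead_ideals_sub I J : ideal_le J I -> ideal_le (lead_ideals J) (lead_ideals I).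
Proof. by move=> IJ a [k]; exists k; exact: (lead_ideal_sub IJ). Qed.

(** Subtracting from a polynomial of [J] one of [I] with the same leading coefficient lowers its
    size. *)
Lemma lead_ideal_inj I J : ideal_le J I ->
  (forall k, ideal_le (lead_ideal k I) (lead_ideal k J)) -> ideal_le I J.
Proof.
move=> IJ lead p; have [n] := ubnP (size p); elim: n p => // n IH p.
rewrite ltnS leq_eqVlt => /orP[/eqP sp|]; last exact: IH.
case: n => [|n] in IH sp *.
  by move: sp => /eqP; rewrite size_poly_eq0 => /eqP -> _; exact: ideal0.
move=> Jp; have [|q [Iq sq pq]] := lead n p`_n.
  by exists p; rewrite sp.
rewrite -[p](subrK q); apply: idealD => //; apply: IH.
  rewrite ltnS; apply/leq_sizeP => i; rewrite leq_eqVlt => /orP[/eqP <-|ni].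
    by rewrite coefB pq subrr.
  by rewrite coefB !nth_default ?subrr // ?sp // (leq_trans sq).
by apply: idealB => //; exact: IJ.
Qed.

Lemma ideal_le_refl (B : comNzRingType) (I : ideal B) : ideal_le I I.
Proof. by []. Qed.

Lemma ideal_le_trans (B : comNzRingType) (I J L : ideal B) :
  ideal_le I J -> ideal_le J L -> ideal_le I L.
Proof. by move=> IJ JL x /JL /IJ. Qed.

(** Nested accessibility inductions replace the usual chain argument: the outer one is on the ideal
    of all leading coefficients, the inner ones on the leading ideals in the finitely many degrees
    below stabilisation. *)
Lemma hilbert_basis : noetherian_ring A -> noetherian_ring {poly A}.
Proof.
move=> noethA; pose lt := strict (@ideal_le {poly A}).
suff H C : forall I, ideal_le (lead_ideals I) C -> Acc lt I.
  by move=> I; exact: H (@ideal_le_refl _ (lead_ideals I)).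
elim: C / (noethA C) => C _ IHC I0 I0C.
have [stop|grow] := pselect (ideal_le C (lead_ideals I0)); last first.
  exact: (IHC (lead_ideals I0)).
have [k0 k0P] := strict_chain_stable (@ideal_le_refl A) (@ideal_le_trans A) noethA
  (fun k => @lead_ideal_succ k I0).
(* Above [I0], either the ideal of all leading coefficients grows, or it only
   matters what happens in degrees less than [k0]. *)
pose settled j I := forall J, ideal_le J I ->
  Acc lt J \/ forall k, (j <= k)%N -> ideal_le (lead_ideal k I) (lead_ideal k J).
suff T j : (j <= k0)%N -> forall I, ideal_le I I0 -> settled j I -> Acc lt I.
  apply: (T k0 _ I0) => // J JI0.
  have [JC|JC] := pselect (ideal_le C (lead_ideals J)); last first.
    left; apply: (IHC (lead_ideals J)) => //; split=> //.
    exact: ideal_le_trans (lead_ideals_sub JI0) I0C.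
  (* A leading coefficient of [J] already occurs for [I0] in some degree [i]; if [i] exceeds [k],
     stabilisation from [k0] on brings it down again. *)
  right=> k k0k a Ja; have [|i I0a] := I0C a; first by apply: JC; exists k.
  have [ik|ki] := leqP i k; first exact: lead_ideal_leq I0a.
  apply: (@lead_ideal_leq k0) => //; apply: k0P I0a.
  exact: leq_trans k0k (ltnW ki).
elim: j => [|j IHj] jk0 I II0 set_I.
  constructor=> J [JI nIJ]; have [//|lead] := set_I J JI.
  by case: nIJ; apply: lead_ideal_inj JI _ => k; exact: lead.
(* Induction on the leading ideal in degree [j]: a larger ideal either enlarges it and is accessible
   by [IHL], or keeps it, so that degree [j] is settled too. *)
have [L LE] : exists L, L = lead_ideal j I by exists (lead_ideal j I).
elim: L / (noethA L) I II0 set_I LE => L _ IHL I II0 set_I LE.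
apply: (IHj (ltnW jk0)) => // J JI.
have [JP|lead] := set_I J JI; first by left.
have [IJ|nIJ] := pselect (ideal_le (lead_ideal j I) (lead_ideal j J)).
  right=> k; rewrite leq_eqVlt => /orP[/eqP <- //|]; exact: lead.
left; apply: (IHL (lead_ideal j J)) => //.
- by rewrite LE; split=> //; exact: lead_ideal_sub.
- exact: ideal_le_trans JI II0.
move=> J' J'J; have [//|lead'] := set_I J' (ideal_le_trans J'J JI); first by left.
right=> k jk; apply: ideal_le_trans (lead' k jk).
exact: lead_ideal_sub.
Qed.

End HilbertBasis.

(** A closed set is recovered from its vanishing ideal, so the order pulls back to the ideals of an
    iterated polynomial ring. Only the evaluations of that ring are retained, which must reach the
    constants and the first [n] coordinates. *)
Lemma closed_sets_wf (K : fieldType) n (T : Type) (le : T -> T -> Prop)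
    (Z : T -> set 'rV[K]_n) :
  (forall t, cl (Z t) `<=` Z t) ->
  (forall s t, le s t -> Z s `<=` Z t) ->
  (forall s t, le s t -> Z t `<=` Z s -> le t s) ->
  well_founded (strict le).
Proof.
move=> Zcl Zle leZ.
have [A [noethA [ev [evC evX]]]] : exists A : comNzRingType, noetherian_ring A /\
    exists ev : (nat -> K) -> {rmorphism A -> K},
      (forall c, exists a, forall x, ev x a = c) /\
      (forall i, (i < n)%N -> exists a, forall x, ev x a = x i).
  elim: n {Z Zcl Zle leZ} => [|n [A [noethA [ev [evC evX]]]]].
    exists K; split; first exact: noetherian_field.
    by exists (fun=> idfun); split=> // c; exists c.
  exists {poly A}; split; first exact: hilbert_basis.
  exists (fun x => horner_eval (x n) \o map_poly (ev x)); split=> [c|i].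
    have [a aE] := evC c; exists a%:P => x /=.
    by rewrite map_polyC /= horner_evalE hornerC aE.
  rewrite ltnS leq_eqVlt => /orP[/eqP ->|/evX[a aE]].
    by exists 'X => x /=; rewrite map_polyX horner_evalE hornerX.
  by exists a%:P => x /=; rewrite map_polyC /= horner_evalE hornerC aE.
pose coords (x : 'rV[K]_n) (i : nat) := if insub i is Some j then x 0 j else 0.
have evP k (f : 'rV[K]_n -> K) : polf k f ->
    exists a, forall x, ev (coords x) a = f x.
  elim=> {k f} [k c|k l lin|k f g _ [a aE] _ [b bE]|j k f g _ [a aE] _ [b bE]].
  - by have [a aE] := evC c; exists a => x.
  - have X (j : 'I_n) : exists a, forall x, ev (coords x) a = x 0 j.
      have [a aE] := evX j (ltn_ord j); exists a => x.
      by rewrite aE /coords valK.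
    have [X' X'E] := choice X.
    have [C CE] := choice (fun j : 'I_n => evC (l (delta_mx 0 j))).
    exists (\sum_j X' j * C j) => x.
    rewrite (scalar_rowE _ lin) big_ord1 rmorph_sum; apply: eq_bigr => j _.
    by rewrite rmorphM /= X'E CE.
  - by exists (a + b) => x; rewrite rmorphD /= aE bE.
  - by exists (a * b) => x; rewrite rmorphM /= aE bE.
pose I t : ideal A := @Ideal A (fun a => forall x, Z t x -> ev (coords x) a = 0)
  (fun x _ => rmorph0 _)
  (fun a b a0 b0 x Zx => etrans (rmorphD _ a b)
    (etrans (congr2 +%R (a0 x Zx) (b0 x Zx)) (addr0 0)))
  (fun a b b0 x Zx => etrans (rmorphM _ a b)
    (etrans (congr2 *%R erefl (b0 x Zx)) (mulr0 _))).
apply: (strict_pullback (phi := I) _ _ noethA) => s t le_st.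
  by move=> a a0 x /(Zle _ _ le_st); exact: a0.
move=> IstP; apply: leZ => // x Zx; apply: Zcl => k f pf f0.
have [a aE] := evP k f pf; rewrite -aE; apply: (IstP a) => // y Zy.
by rewrite aE f0.
Qed.

(** * Polynomial functors in coordinates *)

(* The space [K^n] is the space of row vectors, so that a matrix [A] of size
   (m, n) is a linear map from [K^m] to [K^n] and acts on the right. *)
Record pfunctor (K : fieldType) := PFunctor {
  pdim : nat -> nat;
  pmap : forall m n, 'M[K]_(m, n) -> 'M[K]_(pdim m, pdim n);
  pmap1 : forall n, pmap (1%:M : 'M_n) = 1%:M;
  pmapM : forall m n p (A : 'M_(m, n)) (B : 'M_(n, p)),
    pmap (A *m B) = pmap A *m pmap B
}.

Definition degree_le (K : fieldType) (d : nat) (P : pfunctor K) : Prop :=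
  forall m n i j, polf d (fun A : 'M[K]_(m, n) => pmap P A i j).

(** * Homogeneous parts of a functor through the action of scalars *)

Section ScalarAction.
Variable K : fieldType.
Hypothesis K_infinite : infinite_set [set: K].

Lemma mx_poly_inj_on (g : K -> K) m n d (M N : nat -> 'M[K]_(m, n)) :
  injective g ->
  (forall t, \sum_(e < d) g t ^+ e *: M e = \sum_(e < d) g t ^+ e *: N e) ->
  forall e, (e < d)%N -> M e = N e.
Proof.
move=> g_inj MN e ed; apply/matrixP => i j.
pose p (L : nat -> 'M[K]_(m, n)) := \poly_(e < d) (L e i j).
have pE L t : (p L).[t] = (\sum_(e < d) t ^+ e *: L e) i j.
  by rewrite horner_poly summxE; apply: eq_bigr => k _; rewrite mxE mulrC.
have pMN : p M - p N = 0.
  by apply: poly_fun0_inj g_inj _ => // t; rewrite hornerD hornerN !pE MN subrr.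
have := congr1 (fun q : {poly K} => q`_e) pMN.
by rewrite coefB !coef_poly ed coef0 => /eqP; rewrite subr_eq0 => /eqP.
Qed.

Lemma mx_poly_inj m n d (M N : nat -> 'M[K]_(m, n)) :
  (forall t : K, \sum_(e < d) t ^+ e *: M e = \sum_(e < d) t ^+ e *: N e) ->
  forall e, (e < d)%N -> M e = N e.
Proof. exact: (@mx_poly_inj_on id). Qed.

Variable P : pfunctor K.

(* The scalar [t] acts by the polynomial [\sum_e t ^+ e *: scalar_part n e]. *)
Definition scalar_part n e : 'M[K]_(pdim P n) :=
  \matrix_(i, j) (taylor (fun A : 'M_n => pmap P A i j) 0 1%:M)`_e.

Variable d : nat.
Hypothesis degP : degree_le d P.

Lemma pmap_scalar n t :
  pmap P (t%:M : 'M_n) = \sum_(e < d.+1) t ^+ e *: scalar_part n e.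
Proof.
apply/matrixP => i j; rewrite summxE -[t%:M]scalemx1 -[t *: _]add0r.
rewrite (taylorE (degP i j)) (horner_coef_wide _ (size_taylor K_infinite (degP i j) _ _)).
by apply: eq_bigr => e _; rewrite !mxE mulrC.
Qed.

(** Compare the coefficients of [s] in $P(s)P(t) = P(st)$. Together with [eigen_scalar_part] this
    makes [scalar_part n e] the projector onto the part of degree [e]. *)
Lemma scalar_part_eigen n e t : (e <= d)%N ->
  scalar_part n e *m pmap P t%:M = t ^+ e *: scalar_part n e.
Proof.
move=> ed; pose M e := scalar_part n e *m pmap P t%:M.
apply: (@mx_poly_inj _ _ d.+1 M (fun e => t ^+ e *: scalar_part n e)) => // s.
transitivity (pmap P (s%:M : 'M_n) *m pmap P t%:M).
  by rewrite (pmap_scalar n s) mulmx_suml; apply: eq_bigr => k _; rewrite -scalemxAl.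
rewrite -pmapM -scalar_mxM pmap_scalar; apply: eq_bigr => k _.
by rewrite scalerA exprMn.
Qed.

Lemma scalar_part_natural m n e (A : 'M_(m, n)) : (e <= d)%N ->
  scalar_part m e *m pmap P A = pmap P A *m scalar_part n e.
Proof.
move=> ed; pose M e := scalar_part m e *m pmap P A.
apply: (@mx_poly_inj _ _ d.+1 M (fun e => pmap P A *m scalar_part n e)) => // s.
transitivity (pmap P (s%:M : 'M_m) *m pmap P A).
  by rewrite pmap_scalar mulmx_suml; apply: eq_bigr => k _; rewrite -scalemxAl.
rewrite -pmapM mul_scalar_mx -mul_mx_scalar pmapM pmap_scalar mulmx_sumr.
by apply: eq_bigr => k _; rewrite -scalemxAr.
Qed.

Lemma eigen_scalar_part k n (S : 'M_(k, pdim P n)) e : (e <= d)%N ->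
  (forall t, S *m pmap P t%:M = t ^+ e *: S) -> S *m scalar_part n e = S.
Proof.
move=> ed SE.
have := @mx_poly_inj _ _ d.+1 (fun i => S *m scalar_part n i)
  (fun i => if i == e then S else 0).
move=> /(_ _ e ed); rewrite eqxx; apply => t.
transitivity (S *m pmap P t%:M).
  by rewrite pmap_scalar mulmx_sumr; apply: eq_bigr => i _; rewrite scalemxAr.
rewrite SE (bigD1 (Ordinal (ed : e < d.+1)%N)) //= eqxx big1 ?addr0 // => i.
by rewrite -val_eqE /= => /negPf ->; rewrite scaler0.
Qed.

Lemma rank_factor m n (A : 'M[K]_(m, n)) r : (\rank A <= r)%N ->
  exists (L : 'M_(m, r)) (R : 'M_(r, n)), A = L *m R.
Proof.
move=> rA.
exists (col_base A *m pid_mx (\rank A)), (pid_mx (\rank A) *m row_base A).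
rewrite mulmxA -(mulmxA (col_base A)) mul_pid_mx minnn.
rewrite (minn_idPr rA) pid_mx_1.
by rewrite mulmx1 mulmx_base.
Qed.

(* A function of degree [d] on diagonal matrices vanishes as soon as it vanishes
   on those of rank at most [d], and these factor through [K^d]. *)
Lemma small_support (sigma : {rmorphism K -> K}) n
    (z : 'rV_(pdim P n)) (c : 'cV_(pdim P n)) :
  (forall (L : 'M_(n, d)) (R : 'M_(d, n)),
    z *m map_mx sigma (pmap P L) *m map_mx sigma (pmap P R) *m c = 0) ->
  z *m c = 0.
Proof.
move=> zc0.
have [g gP] := choice (fun ij : 'I_(pdim P n) * 'I_(pdim P n) =>
  let: ex_intro2 g pg gE := polf_twist sigma (degP (m := n) (n := n) ij.1 ij.2) in
  ex_intro (fun g => polf d g /\ forall x, g (map_mx sigma x) =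
      sigma (pmap P x ij.1 ij.2)) g (conj pg gE)).
(* The twisted matrix coefficient as a polynomial in [A]. It is known only at matrices fixed by or
   coming from [sigma], which includes the 0-1 diagonal matrices and the identity. *)
pose phi (A : 'M_n) := \sum_i \sum_j (z 0 i * c j 0) * g (i, j) A.
have pphi : polf d phi.
  by apply: polf_sum => i; apply: polf_sum => j; apply: polfZ; have [] := gP (i, j).
have phiE A : phi (map_mx sigma A) = (z *m map_mx sigma (pmap P A) *m c) 0 0.
  rewrite mxE /phi exchange_big; apply: eq_bigr => j _; rewrite mxE mulr_suml.
  by apply: eq_bigr => i _; have [_ ->] := gP (i, j); rewrite !mxE mulrAC.
have low A : (\rank A <= d)%N -> phi (map_mx sigma A) = 0.
  move=> /rank_factor[L [R ->]].
  by rewrite phiE pmapM map_mxM !mulmxA zc0 mxE.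
have phi0 (s : seq 'I_n) : phi (\sum_(i <- s) delta_mx i i) = 0.
  have [k] := ubnP (size s); elim: k s => // k IH s; rewrite ltnS => sk.
  have [sd|ds] := leqP (size s) d.
    have := low (\sum_(i <- s) delta_mx i i).
    rewrite rmorph_sum /= [X in phi X](eq_bigr (fun i => delta_mx i i)); last first.
      by move=> i _; rewrite map_delta_mx.
    apply; apply: leq_trans sd.
    elim: s {sk} => [|i s IHs]; first by rewrite big_nil mxrank0.
    rewrite big_cons (leq_trans (mxrank_add _ _)) //= -add1n leq_add //.
    by rewrite mxrank_delta.
  have := @polf_subsums _ K_infinite _ _ _ [seq delta_mx i i | i <- s] 0 pphi.
  rewrite size_map big_map add0r; apply=> // b bs nb.
  rewrite add0r -map_mask big_map; apply: IH.
  rewrite size_mask //; apply: leq_trans sk.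
  by rewrite -bs ltn_neqAle count_size andbT -all_count.
have := phi0 (index_enum 'I_n).
have -> : \sum_(i <- index_enum 'I_n) delta_mx i i = map_mx sigma (1%:M : 'M_n).
  by rewrite map_mx1; apply/esym/mx1_sum_delta.
by rewrite phiE pmap1 map_mx1 mulmx1 => e0; apply/matrixP => i j; rewrite !ord1 e0 mxE.
Qed.

Lemma scalar_part_eq0 n e : (e <= d)%N -> scalar_part d e = 0 -> scalar_part n e = 0.
Proof.
move=> ed E0; apply/row_matrixP => i; rewrite row0; apply/rowP => j; rewrite mxE.
have /matrixP/(_ 0 0) : row i (scalar_part n e) *m delta_mx j 0 = 0 :> 'M_1; last first.
  by rewrite -colE !mxE.
apply: (@small_support idfun) => L R; rewrite !map_mx_id //.
by rewrite -row_mul scalar_part_natural // E0 mulmx0 row0 !mul0mx.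
Qed.

End ScalarAction.

Lemma degree_drop (K : fieldType) (K_infinite : infinite_set [set: K])
    (P : pfunctor K) d :
  degree_le d.+1 P -> scalar_part P d.+1 d.+1 = 0 -> degree_le d P.
Proof.
move=> degP E0 m n i j; apply: polf_drop_degree => // A.
exists (\poly_(e < d.+1) (scalar_part P m e *m pmap P A) i j); first exact: size_poly.
move=> t; rewrite -mul_scalar_mx pmapM (pmap_scalar K_infinite degP) big_ord_recr /=.
rewrite (scalar_part_eq0 K_infinite degP _ _ E0) // scaler0 addr0 horner_poly.
rewrite mulmx_suml summxE; apply: eq_bigr => e _.
by rewrite -scalemxAl mxE mulrC.
Qed.

Section Constructions.
Variable K : fieldType.
Hypothesis K_infinite : infinite_set [set: K].

(** * Shifts *)

Lemma shift_map1 (P : pfunctor K) u n :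
  pmap P (block_mx 1%:M 0 0 (1%:M : 'M[K]_n) : 'M_(u + n)) = 1%:M.
Proof. by rewrite -scalar_mx_block pmap1. Qed.

Lemma shift_mapM (P : pfunctor K) u m n p (A : 'M[K]_(m, n)) (B : 'M_(n, p)) :
  pmap P (block_mx 1%:M 0 0 (A *m B) : 'M_(u + m, u + p)) =
  pmap P (block_mx 1%:M 0 0 A) *m pmap P (block_mx 1%:M 0 0 B).
Proof. by rewrite -pmapM mulmx_block !mul0mx !mulmx0 !mulmx1 !addr0 add0r. Qed.

Definition shift (P : pfunctor K) (u : nat) : pfunctor K :=
  PFunctor (fun n => shift_map1 P u n) (@shift_mapM P u).

Lemma degree_shift d (P : pfunctor K) u : degree_le d P -> degree_le d (shift P u).
Proof.
move=> degP m n i j.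
apply: (@eq_polf _ _ _ (fun A => pmap P
  (block_mx 1%:M 0 0 (0 : 'M_(m, n)) + block_mx (0 : 'M_u) 0 0 A) i j)).
  by move=> A; rewrite /= add_block_mx !addr0 add0r.
apply: polf_affine (degP _ _ i j) => a A B.
by rewrite scale_block_mx add_block_mx !scaler0 !addr0.
Qed.

(** With matrices acting on rows from the right, this and the next two are the inclusion of $K^n$ in
    $K^u \oplus K^n$ and the projections to $K^n$ and $K^u$. *)
Definition shift_incl (u n : nat) : 'M[K]_(n, u + n) := row_mx 0 1%:M.
Definition shift_proj (u n : nat) : 'M[K]_(u + n, n) := col_mx 0 1%:M.
Definition base_proj (u n : nat) : 'M[K]_(u + n, u) := col_mx 1%:M 0.

Lemma shift_inclK u n : shift_incl u n *m shift_proj u n = 1%:M.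
Proof. by rewrite mul_row_col mul0mx mulmx1 add0r. Qed.

Lemma shift_incl_base u n : shift_incl u n *m base_proj u n = 0.
Proof. by rewrite mul_row_col mul0mx mulmx0 addr0. Qed.

Lemma shift_incl_natural u m n (A : 'M[K]_(m, n)) :
  shift_incl u m *m block_mx 1%:M 0 0 A = A *m shift_incl u n.
Proof.
by rewrite mul_row_block mul_mx_row !mul0mx !mulmx0 mul1mx mulmx1 !add0r.
Qed.

Lemma shift_proj_natural u m n (A : 'M[K]_(m, n)) :
  block_mx 1%:M 0 0 A *m shift_proj u n = shift_proj u m *m A.
Proof.
by rewrite mul_block_col mul_col_mx !mul0mx !mulmx0 mul1mx mulmx1 !add0r.
Qed.

(** Shifting does not increase the measure: what has weight [d] for the scalars of $K^n$ has no
    degree left for $K^u$, so it survives killing $K^u$ and comes from the degree [d] part of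
    $P(K^n)$. *)
Lemma rank_scalar_part_shift d (P : pfunctor K) u n :
  degree_le d P ->
  (\rank (scalar_part (shift P u) n d) <= \rank (scalar_part P n d))%N.
Proof.
move=> degP; set M := scalar_part (shift P u) n d.
have ME t : M *m pmap P (block_mx 1%:M 0 0 t%:M) = t ^+ d *: M.
  by have := scalar_part_eigen K_infinite (degree_shift degP) n t (leqnn d).
pose N (s : K) := pmap P (block_mx s%:M 0 0 1%:M : 'M_(u + n)).
(* [M *m N s] is a polynomial in [s] of degree 0: by homogeneity its product
   with [s ^+ d] has degree at most [d]. *)
have N01 : M *m N 0 = M *m N 1.
  apply/matrixP => i j.
  have lin (c : 'M_(u + n)) l : polf d (fun A : 'M_(u + n) => (M *m pmap P (c + A)) i l).
    apply: (@eq_polf _ _ _ (fun A => \sum_k M i k * pmap P (c + A) k l)).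
      by move=> A; rewrite mxE.
    apply: polf_sum => k; apply: polfZ.
    exact: (@polf_affine _ _ _ _ _ c id (fun _ _ _ => erefl) (degP _ _ k l)).
  have f1 := lin 0 j; have f2 := lin (block_mx 0 0 0 1%:M) j.
  pose p := taylor (fun A => (M *m pmap P (block_mx 0 0 0 1%:M + A)) i j) 0
    (block_mx 1%:M 0 0 0).
  pose q := taylor (fun A => (M *m pmap P (0 + A)) i j) 0 1%:M.
  have pE s : p.[s] = (M *m N s) i j.
    rewrite -(taylorE f2) add0r scale_block_mx !scaler0 scalemx1 add_block_mx.
    by rewrite !addr0 add0r.
  have qE s : q.[s] = s ^+ d * p.[s].
    rewrite -(taylorE f1) !add0r scalemx1 pE.
    have -> : s%:M = block_mx 1%:M 0 0 s%:M *m block_mx s%:M 0 0 1%:M :> 'M_(u + n).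
      rewrite mulmx_block !mul0mx !mulmx0 !addr0 !add0r mul1mx mulmx1.
      by rewrite -scalar_mx_block.
    by rewrite pmapM mulmxA ME -scalemxAl mxE.
  have {}qE : q = 'X^d * p by apply: poly_fun_inj => // s; rewrite hornerM hornerXn.
  have : (size ('X^d * p : {poly K})%R <= d.+1)%N by rewrite -qE; exact: (size_taylor K_infinite f1).
  have [p0|pn0] := eqVneq p 0; first by rewrite -!pE p0 !horner0.
  rewrite mulrC size_mulXn // -addn1 leq_add2l => /size1_polyC pC.
  by rewrite -!pE pC !hornerC.
have Mproj : M = M *m pmap P (shift_proj u n) *m pmap P (shift_incl u n).
  rewrite -mulmxA -(@pmapM _ P) -[LHS]mulmx1 -(shift_map1 P u n) -/(N 1) -N01.
  congr (_ *m pmap P _); rewrite /shift_proj /shift_incl mul_col_row.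
  rewrite !mul0mx !mulmx0 mulmx1; congr block_mx.
  by apply/matrixP => i j; rewrite !mxE mul0rn.
have -> : \rank M = \rank (M *m pmap P (shift_proj u n)).
  apply/eqP; rewrite eqn_leq {1}Mproj !mxrankM_maxl //.
rewrite -(@eigen_scalar_part _ K_infinite _ _ degP _ n
  (M *m pmap P (shift_proj u n)) _ (leqnn d)) ?mxrankM_maxr // => t.
rewrite -mulmxA -(@pmapM _ P) -shift_proj_natural pmapM mulmxA ME.
by rewrite -scalemxAl.
Qed.

(** * Subfunctors and quotients *)

Record subfunctor (P : pfunctor K) := SubFunctor {
  sdim : nat -> nat;
  sbasis : forall n, 'M[K]_(sdim n, pdim P n);
  sbasis_free : forall n, row_free (sbasis n);
  sbasis_stable : forall m n (A : 'M_(m, n)),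
    (sbasis m *m pmap P A <= sbasis n)%MS
}.

Section Quotient.
Variables (P : pfunctor K) (R : subfunctor P).

Local Notation B := (sbasis R).

Definition smap m n (A : 'M[K]_(m, n)) : 'M_(sdim R m, sdim R n) :=
  B m *m pmap P A *m pinvmx (B n).

Lemma smapE m n (A : 'M_(m, n)) : smap A *m B n = B m *m pmap P A.
Proof. by rewrite mulmxKpV // sbasis_stable. Qed.

Lemma smap1 n : smap (1%:M : 'M_n) = 1%:M.
Proof.
apply: (row_free_inj (sbasis_free R n)).
by rewrite smapE pmap1 mulmx1 mul1mx.
Qed.

Lemma smapM m n p (A : 'M_(m, n)) (C : 'M_(n, p)) : smap (A *m C) = smap A *m smap C.
Proof.
apply: (row_free_inj (sbasis_free R p)).
by rewrite -mulmxA !smapE mulmxA smapE pmapM mulmxA.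
Qed.

Definition sfunctor : pfunctor K := PFunctor smap1 smapM.

Lemma degree_sfunctor d : degree_le d P -> degree_le d sfunctor.
Proof. by move=> degP m n i j; exact: polf_mulmx2. Qed.

(** The projector with kernel [R]. Its rank factorisation gives the quotient map [qproj] and a
    linear section [qlift], which in general is not natural in [n]. *)
Definition qidem n : 'M_(pdim P n) := 1%:M - pinvmx (B n) *m B n.
Definition qdim n := \rank (qidem n).
Definition qproj n : 'M_(pdim P n, qdim n) := locked (col_base (qidem n)).
Definition qlift n : 'M_(qdim n, pdim P n) := locked (row_base (qidem n)).

Lemma qprojK n : qproj n *m qlift n = 1%:M - pinvmx (B n) *m B n.
Proof. by rewrite /qproj /qlift -!lock mulmx_base. Qed.

Lemma sbasisK n : B n *m pinvmx (B n) = 1%:M.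
Proof. by rewrite mulmxVp // sbasis_free. Qed.

Lemma sbasis_qproj n : B n *m qproj n = 0.
Proof.
have : B n *m qproj n *m qlift n = 0 *m qlift n.
  by rewrite -mulmxA qprojK mulmxBr mulmx1 mulmxA sbasisK mul1mx subrr mul0mx.
apply: row_free_inj; rewrite /qlift -lock; exact: row_base_free.
Qed.

Lemma qliftK n : qlift n *m qproj n = 1%:M.
Proof.
have : qproj n *m (qlift n *m qproj n) = qproj n *m 1%:M.
  by rewrite mulmxA qprojK mulmxBl mul1mx -mulmxA sbasis_qproj mulmx0 subr0 mulmx1.
apply: row_full_inj; rewrite /qproj -lock; exact: col_base_full.
Qed.

Lemma qproj_natural m n (A : 'M_(m, n)) :
  qproj m *m (qlift m *m pmap P A *m qproj n) = pmap P A *m qproj n.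
Proof.
rewrite !mulmxA qprojK !mulmxBl mul1mx -[_ *m B m *m _]mulmxA -smapE.
by rewrite -!mulmxA sbasis_qproj !mulmx0 subr0.
Qed.

Definition qmap m n (A : 'M[K]_(m, n)) := qlift m *m pmap P A *m qproj n.

Lemma qmap1 n : qmap (1%:M : 'M_n) = 1%:M.
Proof. by rewrite /qmap pmap1 mulmx1 qliftK. Qed.

Lemma qmapM m n p (A : 'M_(m, n)) (C : 'M_(n, p)) : qmap (A *m C) = qmap A *m qmap C.
Proof. by rewrite /qmap -(mulmxA _ (qproj n)) qproj_natural pmapM !mulmxA. Qed.

Definition quotient : pfunctor K := PFunctor qmap1 qmapM.

Lemma degree_quotient d : degree_le d P -> degree_le d quotient.
Proof. by move=> degP m n i j; exact: polf_mulmx2. Qed.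

Definition homogeneous d : Prop :=
  forall n t, B n *m pmap P (t%:M : 'M_n) = t ^+ d *: B n.

(** The projector of the quotient is the compression of that of [P], and [R], being of weight [d],
    lies in the image of the latter while [qproj] kills it. *)
Lemma rank_scalar_part_quotient d n : degree_le d P -> homogeneous d ->
  (0 < sdim R n)%N ->
  (\rank (scalar_part quotient n d) < \rank (scalar_part P n d))%N.
Proof.
move=> degP homR Rn.
have -> : scalar_part quotient n d = qlift n *m scalar_part P n d *m qproj n.
  apply: (@mx_poly_inj _ K_infinite _ _ d.+1 (scalar_part quotient n)
    (fun e => qlift n *m scalar_part P n e *m qproj n)) => // t.
  rewrite -(pmap_scalar K_infinite (degree_quotient degP)) /= /qmap.
  rewrite (pmap_scalar K_infinite degP) mulmx_sumr mulmx_suml.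
  by apply: eq_bigr => e _; rewrite -scalemxAr -scalemxAl.
rewrite -mulmxA (leq_ltn_trans (mxrankM_maxr _ _)) //.
rewrite -(mxrank_mul_ker _ (qproj n)) -[X in (X < _)%N]addn0 ltn_add2l.
have BE := eigen_scalar_part K_infinite degP (leqnn d) (homR n).
apply: (@leq_trans (\rank (B n))).
  by have := sbasis_free R n; rewrite /row_free => /eqP ->.
apply: mxrankS; rewrite sub_capmx -{1}BE submxMl; apply/sub_kermxP.
exact: sbasis_qproj.
Qed.

Lemma sub_quotient_fiber n (x : 'rV_(pdim P n)) :
  x = x *m qproj n *m qlift n + x *m pinvmx (B n) *m B n.
Proof. by rewrite -mulmxA qprojK mulmxBr mulmx1 -mulmxA subrK. Qed.

End Quotient.

Section ShiftSub.
Variables (P : pfunctor K) (R : subfunctor P) (u : nat).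

(** A copy of [R] itself, not of its shift, placed in the shift of [P] through $K^n \subset K^u
    \oplus K^n$. *)
Definition shift_basis n := sbasis R n *m pmap P (shift_incl u n).

Lemma shift_basis_free n : row_free (shift_basis n).
Proof.
apply/row_freeP; exists (pmap P (shift_proj u n) *m pinvmx (sbasis R n)).
rewrite mulmxA -[_ *m pmap P (shift_proj _ _)]mulmxA -pmapM shift_inclK pmap1 mulmx1.
exact: sbasisK.
Qed.

Lemma shift_basis_stable m n (A : 'M_(m, n)) :
  (shift_basis m *m pmap (shift P u) A <= shift_basis n)%MS.
Proof.
rewrite -mulmxA -pmapM shift_incl_natural pmapM mulmxA -smapE -mulmxA.
exact: submxMl.
Qed.

Definition shift_sub : subfunctor (shift P u) :=
  @SubFunctor (shift P u) _ shift_basis shift_basis_free shift_basis_stable.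

Lemma homogeneous_shift d : homogeneous R d -> homogeneous shift_sub d.
Proof.
move=> homR n t; rewrite /= -mulmxA -pmapM shift_incl_natural pmapM mulmxA homR.
by rewrite -scalemxAl.
Qed.

End ShiftSub.

(** * Twists by an endomorphism of the field *)

(** The twist applies [sigma] to the coefficients of the entries of [P]. Functoriality is inherited
    at matrices over the image of [sigma] and spreads by density, in one matrix at a time. *)
Lemma twist_exists d (P : pfunctor K) (sigma : {rmorphism K -> K}) :
  degree_le d P ->
  exists T : forall m n, 'M[K]_(m, n) -> 'M_(pdim P m, pdim P n),
    [/\ forall m n i j, polf d (fun A : 'M_(m, n) => T m n A i j),
        forall m n (A : 'M_(m, n)), T m n (map_mx sigma A) = map_mx sigma (pmap P A),
        forall n, T n n 1%:M = 1%:M &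
        forall m n p (A : 'M_(m, n)) (B : 'M_(n, p)), T m p (A *m B) = T m n A *m T n p B].
Proof.
move=> degP.
have entry m n i j := cid2 (polf_twist sigma (degP m n i j)).
pose T m n (A : 'M_(m, n)) := \matrix_(i, j) s2val (entry m n i j) A.
have Tpol m n i j : polf d (fun A : 'M_(m, n) => T m n A i j).
  by apply: eq_polf (s2valP (entry m n i j)) => A; rewrite mxE.
have TE m n (A : 'M_(m, n)) : T m n (map_mx sigma A) = map_mx sigma (pmap P A).
  by apply/matrixP => i j; rewrite !mxE (s2valP' (entry m n i j)).
exists T; split=> // [n|m n p A B].
  by rewrite -(map_mx1 sigma) TE pmap1 map_mx1.
apply/matrixP => i j; apply/eqP; rewrite -subr_eq0; apply/eqP.
pose f (A : 'M_(m, n)) (B : 'M_(n, p)) := T m p (A *m B) i j - (T m n A *m T n p B) i j.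
have fl B0 : polf d (f^~ B0).
  apply: polf_add.
    apply: (polf_comp (f := fun C => T m p C i j) (L := mulmxr B0)) => //.
    by move=> a u v; rewrite linearP.
  apply: (@eq_polf _ _ _ (fun A => -1 * \sum_k T n p B0 k j * T m n A i k)).
    by move=> A0; rewrite mulN1r mxE; congr (- _); apply: eq_bigr => k _; rewrite mulrC.
  by apply: polfZ; apply: polf_sum => k; exact: polfZ.
have fr A0 : polf d (f A0).
  apply: polf_add.
    apply: (polf_comp (f := fun C => T m p C i j) (L := mulmx A0)) => //.
    by move=> a u v; rewrite linearP.
  apply: (@eq_polf _ _ _ (fun B => -1 * \sum_k T m n A0 i k * T n p B k j)).
    by move=> B0; rewrite mulN1r mxE.
  by apply: polfZ; apply: polf_sum => k; exact: polfZ.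
apply: (polf_dense K_infinite (fr A) (sigma := sigma)) => B0.
apply: (polf_dense K_infinite (fl (map_mx sigma B0)) (sigma := sigma)) => A0.
by rewrite /f -map_mxM !TE pmapM map_mxM subrr.
Qed.

End Constructions.

(** * Closed subfunctors *)

Section ClosedSubfunctors.
Variable K : fieldType.
Hypothesis K_infinite : infinite_set [set: K].

Record closed_sub (P : pfunctor K) := ClosedSub {
  cset :> forall n, set 'rV[K]_(pdim P n);
  cset_closed : forall n, cl (@cset n) `<=` @cset n;
  cset_stable : forall m n (A : 'M_(m, n)) x, @cset m x -> @cset n (x *m pmap P A)
}.
Arguments cset {P} c n _ : rename.

Definition csub_le (P : pfunctor K) (X Y : closed_sub P) : Prop :=
  forall n, X n `<=` Y n.

Definition noetherian (P : pfunctor K) : Prop := well_founded (strict (@csub_le P)).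

Lemma csub_le_refl (P : pfunctor K) (X : closed_sub P) : csub_le X X.
Proof. by move=> n. Qed.

Lemma csub_le_trans (P : pfunctor K) (X Y Z : closed_sub P) :
  csub_le X Y -> csub_le Y Z -> csub_le X Z.
Proof. by move=> XY YZ n x /XY /YZ. Qed.

Lemma cl_mulmxr m n (B : 'M[K]_(m, n)) (Z : set 'rV_m) (Z' : set 'rV_n) :
  (forall z, Z z -> cl Z' (z *m B)) -> forall x, cl Z x -> cl Z' (x *m B).
Proof. by apply: (cl_comp (L := mulmxr B)) => a u v; rewrite linearP. Qed.

Section ClosureSub.
Variables (P : pfunctor K) (Z : forall n, set 'rV[K]_(pdim P n)).
Hypothesis Zstable :
  forall m n (A : 'M_(m, n)) x, Z x -> cl (@Z n) (x *m pmap P A).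

Lemma closure_sub_stable m n (A : 'M_(m, n)) x :
  cl (@Z m) x -> cl (@Z n) (x *m pmap P A).
Proof. by apply: cl_mulmxr => z; exact: Zstable. Qed.

Definition closure_sub : closed_sub P :=
  ClosedSub (fun n => @cl_idem K _ (@Z n)) closure_sub_stable.

End ClosureSub.

Lemma image_stable (P : pfunctor K) (R : subfunctor P) (X : closed_sub P) m n (A : 'M_(m, n)) x :
  ([set y *m qproj R m | y in X m] : set 'rV_(pdim (quotient R) m)) x ->
  cl ([set y *m qproj R n | y in X n] : set 'rV_(pdim (quotient R) n)) (x *m pmap (quotient R) A).
Proof.
move=> [y Xy <-]; apply: sub_cl; exists (y *m pmap P A); first exact: cset_stable.
by rewrite /= -!mulmxA qproj_natural.
Qed.

(** The closure is taken because a linear projection of a closed set need not be closed. *)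
Definition image (P : pfunctor K) (R : subfunctor P) (X : closed_sub P) : closed_sub (quotient R) :=
  closure_sub (@image_stable P R X).

Lemma image_mono (P : pfunctor K) (R : subfunctor P) (X Y : closed_sub P) :
  csub_le X Y -> csub_le (image R X) (image R Y).
Proof. by move=> XY n; apply: cl_mono => _ [x Xx <-]; exists x => //; exact: XY. Qed.

Definition shift_csub (P : pfunctor K) u (X : closed_sub P) : closed_sub (shift P u) :=
  @ClosedSub (shift P u) (fun n => X (u + n)%N) (fun n => @cset_closed _ X (u + n)%N)
    (fun m n A => @cset_stable _ X (u + m) (u + n) (block_mx 1%:M 0 0 A)).

(** In degree 0 the identity and the zero matrix act alike, so everything factors through $P(K^0)$
    and Hilbert's basis theorem applies there. *)
Lemma noetherian_degree0 (P : pfunctor K) : degree_le 0 P -> noetherian P.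
Proof.
move=> deg0; apply: (closed_sets_wf (Z := fun X : closed_sub P => X 0%N)).
- by move=> X; exact: cset_closed.
- by move=> X Y; apply.
move=> X Y XY YX n y Yy.
have -> : y = y *m pmap P (0 : 'M_(n, 0)) *m pmap P (0 : 'M_(0, n)).
  rewrite -mulmxA -pmapM mulmx0 -[LHS]mulmx1 -pmap1; congr (_ *m _).
  by apply/matrixP => i j; exact: (polf0_cst K_infinite 1%:M 0 (deg0 n n i j)).
by apply: cset_stable; apply: YX; exact: cset_stable.
Qed.

(** Send [X] to the closure of its [sigma]-image. Equations of [X] twist to equations of that image,
    so [X] can be read off from it. *)
Lemma noetherian_twist (P : pfunctor K) d (sigma : {rmorphism K -> K})
    (T : forall m n, 'M[K]_(m, n) -> 'M_(pdim P m, pdim P n)) T1 TM :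
  (forall m n i j, polf d (fun A : 'M_(m, n) => T m n A i j)) ->
  (forall m n (A : 'M_(m, n)), T m n (map_mx sigma A) = map_mx sigma (pmap P A)) ->
  noetherian (@PFunctor K (pdim P) T T1 TM) -> noetherian P.
Proof.
move=> Tpol TE; set P1 := PFunctor T1 TM => noethP1.
pose Z (X : closed_sub P) n : set 'rV[K]_(pdim P1 n) := map_mx sigma @` X n.
have Zstable X m n (A : 'M_(m, n)) x : Z X m x -> cl (Z X n) (x *m pmap P1 A).
  move=> [x0 Xx0 <-] k f pf f0.
  have pfA : polf (k * d) (fun A : 'M_(m, n) => f (map_mx sigma x0 *m T m n A)).
    elim: pf {f0} => {k f} [k c|k l lin|k f g _ IHf _ IHg|j k f g _ IHf _ IHg].
    - exact: polf_cst.
    - apply: (@eq_polf _ _ _ (fun A => \sum_i \sum_j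
          (sigma (x0 0 i) * l (delta_mx 0 j)) * T m n A i j)).
        move=> B; rewrite (scalar_rowE _ lin) big_ord1 exchange_big.
        apply: eq_bigr => j _; rewrite mxE mulr_suml; apply: eq_bigr => i _.
        by rewrite mxE mulrAC.
      apply: polf_sum => i; apply: polf_sum => j; apply: polfZ.
      by apply: polf_le (Tpol m n i j); rewrite mulSn leq_addr.
    - exact: polf_add.
    - by rewrite mulnDl; exact: polf_mul.
  apply: (polf_dense K_infinite (sigma := sigma) pfA) => B.
  by rewrite TE -map_mxM; apply: f0; exists (x0 *m pmap P B) => //; exact: cset_stable.
pose phi X := closure_sub (Zstable X).
apply: (strict_pullback (phi := phi) _ _ noethP1) => X Y XY.
  by move=> n; apply: cl_mono => _ [x Xx <-]; exists x => //; exact: XY.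
move=> YX n y Yy; apply: cset_closed => k f pf f0.
have [g pg gE] := polf_twist sigma pf.
suff : g (map_mx sigma y) = 0 by rewrite gE => /eqP; rewrite fmorph_eq0 => /eqP.
apply: (YX n (map_mx sigma y) _ k g pg); first by apply: sub_cl; exists y.
by move=> _ [x Xx <-]; rewrite gE f0 // rmorph0.
Qed.

End ClosedSubfunctors.
Arguments csub_le_refl {K P} X n _ _ : rename.

Section Spans.
Variable K : fieldType.

Lemma exists_span (I : Type) n (G : I -> 'rV[K]_n) :
  exists k (B : 'M[K]_(k, n)),
    (forall j, exists i, row j B = G i) /\ forall i, (G i <= B)%MS.
Proof.
suff H r k (B : 'M[K]_(k, n)) : (n - \rank B <= r)%N ->
    (forall j, exists i, row j B = G i) -> exists k (B : 'M[K]_(k, n)),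
    (forall j, exists i, row j B = G i) /\ forall i, (G i <= B)%MS.
  by apply: (H n 0%N 0); [rewrite leq_subr|case].
elim: r k B => [|r IH] k B rB BG.
  exists k, B; split=> // i; apply: submx_full.
  by rewrite -col_leq_rank -subn_eq0 -leqn0.
have [full|/existsNP[i /negP nGi]] := pselect (forall i, (G i <= B)%MS).
  by exists k, B.
apply: (IH _ (col_mx B (G i))) => [|j].
  have : (\rank B < \rank (col_mx B (G i)))%N.
    rewrite -addsmxE; apply: rank_ltmx; rewrite ltmxE addsmxSl /=.
    by apply: contra nGi; apply: submx_trans; exact: addsmxSr.
  move: rB; rewrite !leq_subLR => rB lt.
  by rewrite (leq_trans rB) // addnS -addSn leq_add2r.
case: (split_ordP j) => l ->.
  by have [i' BE] := BG l; exists i'; rewrite rowKu BE.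
by exists i; rewrite rowKd ord1 row_id.
Qed.

Lemma annihilator_exists (I : Type) n (C : I -> 'cV[K]_n) :
  exists N : 'M[K]_n, forall m (z : 'M_(m, n)), (z <= N)%MS <-> forall i, z *m C i = 0.
Proof.
have [k [B [BG GB]]] := exists_span (fun i => (C i)^T).
exists (kermx B^T) => m z; split=> [/sub_kermxP zB i|zC].
  have /submxP[w wE] := GB i.
  by rewrite -[C i]trmxK wE trmx_mul mulmxA zB mul0mx.
apply/sub_kermxP; apply/trmx_inj; rewrite trmx_mul trmxK trmx0.
apply/row_matrixP => j; rewrite row0 row_mul.
have [i ->] := BG j.
by rewrite -trmx_mul zC trmx0.
Qed.

(** Having no common zero, the linear forms [C i] span the dual space; finitely many of them already
    do, which gives the right inverse [W]. *)
Lemma trivial_annihilator (I : Type) n (C : I -> 'cV[K]_n) :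
  (forall z : 'rV_n, (forall i, z *m C i = 0) -> z = 0) ->
  exists k (psi : 'I_k -> I) (W : 'M_(k, n)),
    (\matrix_(l, j) C (psi j) l 0) *m W = 1%:M.
Proof.
move=> triv; have [k [B [BG GB]]] := exists_span (fun i => (C i)^T).
have [psi psiE] := choice BG; exists k, psi.
have -> : (\matrix_(l, j) C (psi j) l 0) = B^T.
  apply/matrixP => l j; have := congr1 (fun M : 'rV_n => M 0 l) (psiE j).
  by rewrite !mxE => ->.
apply/row_freeP; rewrite -kermx_eq0; apply/eqP/row_matrixP => i; rewrite row0.
apply: triv => j; have /submxP[w wE] := GB j.
by rewrite -[C j]trmxK wE trmx_mul mulmxA -row_mul mulmx_ker row0 mul0mx.
Qed.

End Spans.

(** * The inductive step *)

Section InductiveStep.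
Variable K : fieldType.
Hypothesis K_infinite : infinite_set [set: K].
Variables (P : pfunctor K) (d : nat).
Hypotheses (d_gt0 : (0 < d)%N) (degP : degree_le d P).
Variable R : subfunctor P.
Hypothesis homR : homogeneous R d.

(* Twists come in because, in positive characteristic, the lowest part of a
   Taylor expansion along [R] may only be Frobenius-semilinear. *)
Definition stably_simple : Prop :=
  forall (sigma : {rmorphism K -> K}) (N : forall n, 'M[K]_(sdim R n)),
    (forall m n (A : 'M_(m, n)), (N m *m map_mx sigma (smap R A) <= N n)%MS) ->
    (forall n, N n = 0) \/ (forall n, row_full (N n)).
Hypothesis simpleR : stably_simple.

Local Notation B := (sbasis R).
Local Notation q := (qproj R).

Section FixImage.
Variable C : closed_sub (quotient R).

Definition pre n : set 'rV[K]_(pdim P n) := [set x | C n (x *m q n)].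

Lemma pre_sub n x (s : 'rV_(sdim R n)) : pre x -> pre (x + s *m B n).
Proof. by rewrite /pre /= mulmxDl -mulmxA sbasis_qproj mulmx0 addr0. Qed.

Lemma pre_stable m n (A : 'M_(m, n)) x : pre x -> pre (x *m pmap P A).
Proof.
by move=> /(cset_stable A); rewrite /pre /= -mulmxA qproj_natural mulmxA.
Qed.

Lemma image_pre (X : closed_sub P) : csub_le (image R X) C -> forall n, X n `<=` pre (n := n).
Proof. by move=> XC n x Xx; apply: XC; apply: sub_cl; exists x. Qed.

Section Direction.
Variables (k u : nat) (f : 'rV[K]_(pdim P u) -> K).
Hypothesis pf : polf k f.
Variable m : nat.
Hypothesis m_gt0 : (0 < m)%N.
Hypothesis low : forall i x (s : 'rV_(sdim R u)), (0 < i < m)%N -> pre x ->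
  (taylor f x (s *m B u))`_i = 0.

(** For fixed [s] this is the function [h]: [m] is the least positive order, over the whole preimage
    of [C], of a nonzero Taylor coefficient along [R]. *)
Definition dirderiv x (s : 'rV_(sdim R u)) := (taylor f x (s *m B u))`_m.

(** The Taylor term of order [i] contributes a multiple of $t^{ei}$. Orders strictly between 0 and
    [m] vanish along the curve, orders above [m] come too late, and order [m] contributes its value
    at [t = 0]. *)
Lemma curve_coef (y : K -> 'rV_(pdim P u)) (s : 'rV_(sdim R u)) e (q1 q0 : {poly K}) :
  pcurve y -> (forall t, pre (y t)) -> (0 < e)%N ->
  (forall t, f (y t + t ^+ e *: (s *m B u)) = q1.[t]) ->
  (forall t, f (y t) = q0.[t]) ->
  q1`_(e * m) = q0`_(e * m) + dirderiv (y 0) s.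
Proof.
move=> py ypre e0 q1E q0E.
have [E EE] := choice (fun i => polf_pcurve py (polf_taylor K_infinite pf i (s *m B u))).
have E0 : E 0%N = q0.
  by apply: poly_fun_inj => // t; rewrite -EE -q0E (taylor0 pf).
have Elow i : (0 < i < m)%N -> E i = 0.
  by move=> im; apply: poly_fun0 => // t; rewrite -EE low.
have -> : q1 = \sum_(i < maxn k.+1 m.+1) E i * 'X^(e * i).
  apply: poly_fun_inj => // t; rewrite -q1E (taylorE pf) horner_sum.
  rewrite (horner_coef_wide _ (leq_trans (size_taylor K_infinite pf _ _) (leq_maxl _ m.+1))).
  by apply: eq_bigr => i _; rewrite hornerM hornerXn -EE exprM.
have mk : (m < maxn k.+1 m.+1)%N by rewrite leq_max ltnSn orbT.
have z_lt : (0 < maxn k.+1 m.+1)%N by rewrite leq_max.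
rewrite coef_sum (bigD1 (Ordinal z_lt)) //= muln0 expr0 mulr1 E0; congr (_ + _).
rewrite (bigD1 (Ordinal mk)) //=; last by rewrite -val_eqE /= -lt0n.
rewrite coefMXn ltnn subnn -horner_coef0 -EE /dirderiv big1 ?addr0 // => i.
rewrite -!val_eqE /= => /andP[]; rewrite -lt0n => i0 im.
rewrite coefMXn; case: ltnP => // le_im; rewrite Elow ?coef0 //.
by rewrite i0 ltn_neqAle im /=; rewrite leq_pmul2l in le_im.
Qed.

(** Additivity is due to the minimality of [m]: the line through [x] in direction [s] stays in the
    preimage, where the lower orders in [s'] vanish. This is [curve_coef] with exponent 1. *)
Lemma dirderivD x s s' : pre x -> dirderiv x (s + s') = dirderiv x s + dirderiv x s'.
Proof.
move=> prex; have := @curve_coef (fun t => x + t *: (s *m B u)) s' 1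
  (taylor f x ((s + s') *m B u)) (taylor f x (s *m B u)).
rewrite scale0r addr0 mul1n; apply=> //.
- exact: pcurve_line.
- by move=> t; rewrite scalemxAl; exact: pre_sub.
- by move=> t; rewrite expr1 -addrA -scalerDr -mulmxDl (taylorE pf).
- by move=> t; rewrite (taylorE pf).
Qed.

Lemma dirderivZ x a s : dirderiv x (a *: s) = a ^+ m * dirderiv x s.
Proof. by rewrite /dirderiv -scalemxAl (taylorZ K_infinite pf). Qed.

Lemma dirderiv_additive x s : pre x -> dirderiv x s != 0 ->
  forall a b : K, (a + b) ^+ m = a ^+ m + b ^+ m.
Proof.
move=> prex s0 a b; apply: (mulIf s0).
by rewrite -dirderivZ scalerDl dirderivD // !dirderivZ mulrDl.
Qed.

Variable sigma : {rmorphism K -> K}.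
Hypothesis sigmaE : forall a, sigma a = a ^+ m.

Definition gradient x : 'cV[K]_(sdim R u) := \col_i dirderiv x (delta_mx 0 i).

Lemma dirderivE x s : pre x -> dirderiv x s = (map_mx sigma s *m gradient x) 0 0.
Proof.
move=> prex; have d0 : dirderiv x 0 = 0.
  by rewrite -[0](scale0r 0) dirderivZ expr0n; case: m m_gt0 => // m' _; rewrite mul0r.
rewrite [s in LHS]row_sum_delta mxE.
transitivity (\sum_j dirderiv x (s 0 j *: delta_mx 0 j)).
  by elim/big_rec2: _ => // j _ y _ <-; rewrite dirderivD.
by apply: eq_bigr => j _; rewrite dirderivZ !mxE sigmaE.
Qed.

Lemma ispol_gradient l : ispol (fun x => gradient x l 0).
Proof.
exists (k - m)%N; apply: eq_polf (polf_taylor K_infinite pf m (delta_mx 0 l *m B u)).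
by move=> x; rewrite mxE.
Qed.

(** The identity on $K^u$ and [t] times [psi] on $K^n$; at [t = 0] it is the base projection, and on
    the copy of [R] it acts through $R(t\psi) = t^d R(\psi)$. *)
Definition slope n (psi : 'M[K]_(n, u)) (t : K) : 'M_(u + n, u) := col_mx 1%:M (t *: psi).

Lemma slope_curve n (psi : 'M[K]_(n, u)) i j :
  exists p : {poly K}, forall t, pmap P (slope psi t) i j = p.[t].
Proof.
exists (taylor (fun A : 'M_(u + n, u) => pmap P A i j) (col_mx 1%:M 0) (col_mx 0 psi)).
move=> t; rewrite -(taylorE (degP i j)) scale_col_mx scaler0 add_col_mx.
by rewrite addr0 add0r.
Qed.

Lemma slope_expansion n (psi : 'M[K]_(n, u)) :
  exists Phi : 'rV_(pdim P (u + n)) -> {poly K},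
    (forall i, ispol (fun y => (Phi y)`_i)) /\
    forall y t, f (y *m pmap P (slope psi t)) = (Phi y).[t].
Proof.
have [Phi ? ?] := polf_row_curve pf (slope_curve psi).
by exists Phi.
Qed.

(** The exponent [d * m] combines the degree [d] of [R], which scales the fibre coordinate by $t^d$,
    with the order [m] of the lowest Taylor part. *)
Lemma slope_coef n (psi : 'M[K]_(n, u)) (Phi : 'rV_(pdim P (u + n)) -> {poly K}) y
    (s : 'rV_(sdim R n)) :
  (forall y t, f (y *m pmap P (slope psi t)) = (Phi y).[t]) -> pre y ->
  (Phi (y + s *m B n *m pmap P (shift_incl K u n)))`_(d * m) =
  (Phi y)`_(d * m) + (map_mx sigma s *m map_mx sigma (smap R psi) *m
                      gradient (y *m pmap P (base_proj K u n))) 0 0.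
Proof.
move=> PhiE prey.
have slope0 : base_proj K u n = slope psi 0 by rewrite /slope scale0r.
rewrite -map_mxM -dirderivE; last by apply: pre_stable.
rewrite slope0.
apply: (curve_coef (y := fun t => y *m pmap P (slope psi t))) => //.
- by apply: pcurve_rowM => i j; exact: slope_curve.
- by move=> t; exact: pre_stable.
move=> t; rewrite -PhiE; congr f; rewrite mulmxDl; congr (_ + _).
rewrite -(mulmxA _ (pmap P (shift_incl K u n))) -(@pmapM _ P) mul_row_col mul0mx mul1mx add0r.
rewrite -(mul_scalar_mx t psi) pmapM mulmxA -(mulmxA s (B n)) homR -scalemxAr -scalemxAl.
by rewrite -(mulmxA s (smap R psi)) smapE mulmxA.
Qed.

Lemma pre_lift n (y : 'rV_(pdim P (u + n))) : pre y ->
  pre (y *m qproj (shift_sub R u) n *m qlift (shift_sub R u) n).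
Proof.
move=> prey; pose s := y *m pinvmx (shift_basis R u n).
have -> : y *m qproj (shift_sub R u) n *m qlift (shift_sub R u) n =
    y + (- s *m smap R (shift_incl K u n)) *m B (u + n).
  rewrite -[(- s *m _) *m _]mulmxA smapE mulNmx.
  by rewrite [y in RHS](sub_quotient_fiber (shift_sub R u)) addrK.
exact: pre_sub.
Qed.

(** The base projection is zero on $K^n$ and so kills the copy of [R], which has positive degree.
    Hence the gradient depends only on the image in the quotient. *)
Lemma lift_base n (y : 'rV_(pdim P (u + n))) :
  y *m qproj (shift_sub R u) n *m qlift (shift_sub R u) n *m pmap P (base_proj K u n) =
  y *m pmap P (base_proj K u n).
Proof.
rewrite [y in RHS](sub_quotient_fiber (shift_sub R u)) mulmxDl.
rewrite [X in _ = _ + X](_ : _ = 0) ?addr0 //.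
rewrite /= -!mulmxA -(@pmapM _ P) shift_incl_base.
have -> : (0 : 'M[K]_(n, u)) = 0%:M *m 0 by rewrite mulmx0.
by rewrite pmapM (mulmxA (B n)) homR expr0n eqn0Ngt d_gt0 scale0r mul0mx !mulmx0.
Qed.

(** For [g] vanishing on [X1], Cramer's rule turns a determinant power times the twist of [g] into a
    function [G] of the quotient image alone. [G] vanishes on the image of [X1], hence on that of
    [x], where the determinant is 1. *)
Lemma recover (X X1 X2 : closed_sub P) n x s0 :
  csub_le (image R X) C -> (forall y, X u y -> f y = 0) ->
  csub_le X1 X -> csub_le X2 X ->
  csub_le (image (shift_sub R u) (shift_csub u X2)) (image (shift_sub R u) (shift_csub u X1)) ->
  X2 (u + n)%N x -> dirderiv (x *m pmap P (base_proj K u n)) s0 != 0 ->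
  X1 (u + n)%N x.
Proof.
move=> XC fX X1X X2X W21 X2x xs0.
have prex y : X (u + n)%N y -> pre y by exact: image_pre.
set Rs := shift_sub R u; set h0 := gradient (x *m pmap P (base_proj K u n)).
have h0n0 : h0 != 0.
  apply: contra xs0 => /eqP h00; rewrite dirderivE -/h0 ?h00 ?mulmx0 ?mxE //.
  by apply: pre_stable; apply: prex; exact: X2X.
(* By simplicity, the linear forms [z |-> z *m map_mx sigma (smap R psi) *m h0]
   have no common zero. *)
have ann n' := cid (annihilator_exists
  (fun psi : 'M[K]_(n', u) => map_mx sigma (smap R psi) *m h0)).
pose N n' := projT1 (ann n'); have NP n' := projT2 (ann n').
have Nstable m' n' (A : 'M_(m', n')) : (N m' *m map_mx sigma (smap R A) <= N n')%MS.
  apply/NP => psi; rewrite -mulmxA (mulmxA (map_mx sigma (smap R A))) -map_mxM -smapM.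
  by have [/(_ (submx_refl _)) + _] := NP m' _ (N m'); apply.
have N0 n' : N n' = 0.
  (* In the full case the identity matrix is annihilated, and [psi = 1] forces [h0 = 0]. *)
  have [//|full] := simpleR Nstable.
  case/negP: h0n0; apply/eqP.
  have [/(_ (submx_full _ (full u))) /(_ 1%:M) + _] := NP u _ (1%:M : 'M_(sdim R u)).
  by rewrite smap1 map_mx1 !mul1mx.
have [|kk [psi [Wt psiW]]] := trivial_annihilator
    (C := fun psi : 'M[K]_(n, u) => map_mx sigma (smap R psi) *m h0).
  by move=> z /NP; rewrite -/(N n) N0 submx0 => /eqP.
have [Phi PhiP] := choice (fun j => slope_expansion (psi j)).
(* [Wt] is the right inverse found at [x] and stays fixed while [y] varies; thus [M] is square,
   polynomial in [y], and the identity at [x]. *)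
pose M (y : 'rV_(pdim P (u + n))) : 'M[K]_(sdim R n) := (\matrix_(l, j)
  (map_mx sigma (smap R (psi j)) *m gradient (y *m pmap P (base_proj K u n))) l 0) *m Wt.
pose V (y : 'rV_(pdim P (u + n))) : 'rV[K]_(sdim R n) :=
  - (\row_j (Phi j y)`_(d * m)) *m Wt.
(* On [X], the twisted fibre coordinate of [y] over the quotient solves a linear
   system whose coefficients depend only on the image of [y]. *)
have VM (y : 'rV_(pdim P (u + n))) : X (u + n)%N y ->
    let z := y *m qproj Rs n *m qlift Rs n in
    map_mx sigma (y *m pinvmx (sbasis Rs n)) *m M z = V z.
  move=> Xy z; set s := y *m _.
  have yE : y = z + s *m B n *m pmap P (shift_incl K u n).
    by rewrite [LHS](sub_quotient_fiber Rs) -[s *m _ *m _]mulmxA.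
  rewrite /M /V mulmxA; congr (_ *m Wt); apply/rowP => j; rewrite !mxE.
  have prez : pre z by apply: pre_lift; exact: prex.
  have [_ PhiE] := PhiP j.
  have := slope_coef s PhiE prez; rewrite -yE.
  have -> : Phi j y = 0.
    by apply: poly_fun0 => // t; rewrite -PhiE fX //; exact: cset_stable.
  rewrite coef0 => /eqP; rewrite eq_sym addrC addr_eq0 => /eqP <-.
  rewrite -mulmxA [RHS]mxE; apply: eq_bigr => l _.
  by rewrite [X in _ * X = _]mxE.
apply: cset_closed => kg g pg g0.
(* The system only determines [sigma] of the fibre coordinate, so [g] is evaluated through its twist
   at [sigma y]. *)
have [gt pgt gtE] := polf_twist sigma pg.
pose Z : lmodType K := 'rV[K]_(qdim Rs n).
pose lift (z : Z) : 'rV_(pdim P (u + n)) := z *m qlift Rs n.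
have ispol_lift (F : 'rV_(pdim P (u + n)) -> K) : ispol F -> ispol (fun z => F (lift z)).
  by move=> [k' pF]; exists k'; exact: (@polf_mulmxr K _ _ _ k' F (qlift Rs n) pF).
have ispol_M i j : ispol (fun z => M (lift z) i j).
  apply: (ispol_lift (fun y => M y i j)).
  apply: ispol_mulmx => [l j'|l j']; last exact: ispol_cst.
  apply: (@eq_ispol _ _ (fun y => (map_mx sigma (smap R (psi j')) *m
      gradient (y *m pmap P (base_proj K u n))) l 0)) => [y|]; first by rewrite [RHS]mxE.
  apply: ispol_mulmx => [a b|a b]; first exact: ispol_cst.
  rewrite ord1; have [k' pk'] := ispol_gradient a; exists k'.
  exact: (@polf_mulmxr K _ _ _ k' (fun x => gradient x a 0) _ pk').
have ispol_V i j : ispol (fun z => V (lift z) i j).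
  apply: (ispol_lift (fun y => V y i j)).
  apply: ispol_mulmx => [l j'|l j']; last exact: ispol_cst.
  have [pPhi _] := PhiP j'.
  by apply: eq_ispol (ispolN (pPhi (d * m)%N)) => y; rewrite !mxE.
have ispol_a j : ispol (fun z => map_mx sigma (lift z) 0 j).
  apply: (@eq_ispol _ _ (fun z => lift z 0 j ^+ m)) => [z|]; first by rewrite [RHS]mxE sigmaE.
  apply: ispolX; apply: (ispol_lift (fun y => y 0 j)); exists 1%N; exact: polf_entry.
have ispol_T j : ispol (fun z => (V (lift z) *m \adj (M (lift z))) 0 j).
  by apply: ispol_mulmx => // i j'; exact: ispol_adj.
have [G [kG pG] GE] := polf_clear_denominator (map_mx sigma (sbasis Rs n)) pgt
  ispol_a ispol_T (ispol_det ispol_M).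
have GX (y : 'rV_(pdim P (u + n))) : X (u + n)%N y ->
    \det (M (lift (y *m qproj Rs n))) ^+ kg * sigma (g y) = G (y *m qproj Rs n).
  move=> Xy; rewrite -(GE _ (map_mx sigma (y *m pinvmx (sbasis Rs n)))).
    rewrite -gtE; congr (_ * gt _); rewrite -map_mxM -map_mxD; congr map_mx.
    exact: (sub_quotient_fiber Rs y).
  by rewrite -VM // -mulmxA mul_mx_adj mul_mx_scalar.
have G0 : G (x *m qproj Rs n) = 0.
  apply: (W21 n (x *m qproj Rs n) _ kG G pG); first by apply: sub_cl; exists x.
  by move=> _ [y X1y <-]; rewrite -GX ?g0 ?rmorph0 ?mulr0 //; exact: X1X.
have := GX x (X2X _ _ X2x); rewrite G0.
have -> : M (lift (x *m qproj Rs n)) = 1%:M.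
  by rewrite -psiW /M /lift lift_base.
by rewrite det1 expr1n mul1r => /eqP; rewrite fmorph_eq0 => /eqP.
Qed.

End Direction.
End FixImage.
End InductiveStep.

Section NoetherianStep.
Variable K : fieldType.
Hypothesis K_infinite : infinite_set [set: K].

Section VanishingLocus.
Variables (P : pfunctor K) (u k : nat) (h : 'rV[K]_(pdim P u) -> K).
Hypothesis ph : polf k h.
Variable X : closed_sub P.

Definition vanishing_set n : set 'rV[K]_(pdim P n) :=
  [set x | X n x /\ forall A : 'M_(n, u), h (x *m pmap P A) = 0].

Lemma vanishing_closed n : cl (@vanishing_set n) `<=` @vanishing_set n.
Proof.
move=> x clx; split.
  by apply: cset_closed; apply: cl_mono clx => y [].
move=> A; apply: (clx k (fun y => h (y *m pmap P A))) => [|y [_ ->]//].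
exact: (@polf_mulmxr K _ _ _ k h _ ph).
Qed.

Lemma vanishing_stable m n (A : 'M_(m, n)) x :
  vanishing_set x -> vanishing_set (x *m pmap P A).
Proof.
move=> [Xx hx]; split=> [|A']; first exact: cset_stable.
by rewrite -mulmxA -pmapM.
Qed.

Definition vanishing_sub : closed_sub P := ClosedSub vanishing_closed vanishing_stable.

End VanishingLocus.

Variables (P : pfunctor K) (d : nat).
Hypotheses (d_gt0 : (0 < d)%N) (degP : degree_le d P).
Variable R : subfunctor P.
Hypotheses (homR : homogeneous R d) (simpleR : stably_simple R).
Hypothesis noethQ : noetherian (quotient R).
Hypothesis noethS : forall u, noetherian (quotient (shift_sub R u)).

Local Notation acc := (Acc (strict (@csub_le K P))).

Lemma acc_of_equation (C : closed_sub (quotient R)) :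
  (forall C', strict (@csub_le K _) C' C -> forall X, csub_le (image R X) C' -> acc X) ->
  forall k u (f : 'rV_(pdim P u) -> K) X, polf k f -> csub_le (image R X) C ->
    (forall y, X u y -> f y = 0) -> (exists2 x, pre C x & f x != 0) -> acc X.
Proof.
move=> IHC k; have [b kb] := ubnP k.
elim: b k kb => [|b IHb] k kb u f X pf XC fX [x1 prex1 fx1]; first by case: k kb {pf}.
have [CX|nCX] := pselect (csub_le C (image R X)).
  2: exact: (IHC _ (conj XC nCX) X (csub_le_refl _)).
pose Q i := exists x (s : 'rV_(sdim R u)),
  [/\ (0 < i)%N, pre C x & (taylor f x (s *m sbasis R u))`_i != 0].
(* Otherwise [f] is constant along [R] on the preimage and descends to the quotient; vanishing on
   the image of [X], which is dense in [C], it would vanish on the whole preimage. *)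
have exQ : exists i, `[< Q i >].
  apply: contrapT => noQ.
  have f_inv x (s : 'rV_(sdim R u)) : pre C x -> f (x + s *m sbasis R u) = f x.
    move=> prex; rewrite -[s *m _]scale1r (taylorE pf) -(taylor0 pf x (s *m sbasis R u)).
    rewrite [taylor _ _ _ in LHS]size1_polyC ?hornerC //.
    apply/leq_sizeP => i i0; apply/eqP; apply: contrapT => /negP ci.
    by case: noQ; exists i; apply/asboolP; exists x, s.
  case/negP: fx1; apply/eqP.
  have f_lift x : pre C x -> f (x *m qproj R u *m qlift R u) = f x.
    move=> prex; rewrite -[in RHS](f_inv x (- (x *m pinvmx (sbasis R u)))) // mulNmx.
    by congr f; apply: (canRL (addrK _)); exact: esym (sub_quotient_fiber R x).
  rewrite -f_lift //; apply: (CX u _ prex1 k (fun w => f (w *m qlift R u))).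
    exact: (@polf_mulmxr K _ _ _ k f (qlift R u) pf).
  by move=> _ [z Xz <-]; rewrite f_lift ?fX //; exact: image_pre Xz.
have [m /asboolP[x0 [s0 [m_gt0 prex0 dx0]]] mmin] := ex_minnP exQ.
have low i x (s : 'rV_(sdim R u)) : (0 < i < m)%N -> pre C x ->
    (taylor f x (s *m sbasis R u))`_i = 0.
  move=> /andP[i0 im] prex; apply/eqP; apply: contrapT => /negP ci.
  have /asboolP/mmin : Q i by exists x, s.
  by rewrite leqNgt im.
have [sigma sigmaE] := pow_rmorph m_gt0
  (dirderiv_additive K_infinite pf m_gt0 low prex0 dx0).
pose h x := dirderiv (R := R) f m x s0.
have ph : polf (k - m) h := polf_taylor K_infinite pf m (s0 *m sbasis R u).
have k_gt0 : (0 < k)%N.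
  rewrite lt0n; apply: contra dx0 => /eqP k0; apply/eqP/nth_default.
  by have := size_taylor K_infinite pf x0 (s0 *m sbasis R u); rewrite k0 => /leq_trans; apply.
have accV : acc (vanishing_sub ph X).
  apply: (IHb (k - m)%N _ u h) => //.
  - by rewrite -ltnS; apply: leq_trans kb; rewrite ltnS ltn_subrL m_gt0.
  - by apply: csub_le_trans XC; apply: image_mono => n x [].
  - by move=> y [_ /(_ 1%:M)]; rewrite pmap1 mulmx1.
  - by exists x0.
(* A closed subset of [X] is controlled by the pair of [W] and the vanishing locus of [h], both of
   which range over accessible sets. *)
pose W X' := image (shift_sub R u) (shift_csub u X').
refine (@Acc_strict_prod _ _ _ _ _ _ W (vanishing_sub ph) (fun X' => csub_le X' X)
  _ _ _ _ _ _ _ _ (W X) (@noethS u _) _ accV X (csub_le_refl X) (csub_le_refl _)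
  (csub_le_refl _)).
- exact: csub_le_refl.
- exact: csub_le_refl.
- exact: csub_le_trans.
- exact: csub_le_trans.
- by move=> X1 X2 X1X X21; exact: csub_le_trans X1X.
- by move=> X1 X2 X12; apply: image_mono => n; exact: X12.
- by move=> X1 X2 X12 n x [/X12].
move=> X2 X1 X2X X12 W21 V21 n x X2x.
have [hx|/existsNP[A hxA]] := pselect (forall A : 'M_(n, u), h (x *m pmap P A) = 0).
  by have [] : vanishing_sub ph X1 n x by apply: V21.
(* The graph of [A] moves [x] into $P(K^{u+n})$ so that its base projection is the point where [h]
   is nonzero, and [shift_proj] brings it back. *)
have -> : x = x *m pmap P (row_mx A 1%:M) *m pmap P (shift_proj K u n).
  by rewrite -mulmxA -pmapM mul_row_col mulmx0 mulmx1 add0r pmap1 mulmx1.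
apply: cset_stable.
apply: (recover K_infinite d_gt0 degP homR simpleR pf m_gt0 low sigmaE XC fX _ X2X W21) => //.
- exact: csub_le_trans X12 X2X.
- exact: cset_stable.
rewrite -mulmxA -pmapM mul_row_col mulmx1 mulmx0 addr0; apply/eqP; exact: hxA.
Qed.

(** A proper closed subset [X1] of [X] must satisfy an equation that fails somewhere on the preimage
    of [C]; otherwise it would contain that preimage and hence [X]. *)
Lemma noetherian_step : noetherian P.
Proof.
suff H C : forall X, csub_le (image R X) C -> acc X by move=> X; exact: H (csub_le_refl _).
elim: C / (noethQ C) => C _ IHC X XC; constructor=> X1 [X1X nXX1].
have X1C : csub_le (image R X1) C := csub_le_trans (image_mono X1X) XC.
have [[k [u [f [pf [fX1 fC]]]]]|none] := pselect (exists k u (f : 'rV_(pdim P u) -> K),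
    polf k f /\ (forall y, X1 u y -> f y = 0) /\ exists2 x, pre C x & f x != 0).
  exact: acc_of_equation IHC _ _ _ _ pf X1C fX1 fC.
case: nXX1 => n x Xx; apply: cset_closed => k f pf fX1.
apply/eqP; apply: contrapT => /negP fx; case: none.
exists k, n, f; split=> //; split=> //; exists x => //; exact: image_pre Xx.
Qed.

End NoetherianStep.

(** * Noetherianity of polynomial functors *)

Section Noetherianity.
Variable K : fieldType.
Hypothesis K_infinite : infinite_set [set: K].

Lemma family_support (P : pfunctor K) d (sigma : {rmorphism K -> K})
    (k : nat -> nat) (N : forall n, 'M[K]_(k n, pdim P n)) :
  degree_le d P ->
  (forall m n (A : 'M_(m, n)), (N m *m map_mx sigma (pmap P A) <= N n)%MS) ->
  (N d = 0 -> forall n, N n = 0) /\ (row_full (N d) -> forall n, row_full (N n)).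
Proof.
move=> degP Nst; split=> [N0 n|full n].
  apply/row_matrixP => i; rewrite row0; apply/rowP => j; rewrite mxE.
  have /matrixP/(_ 0 0) : row i (N n) *m delta_mx j 0 = 0 :> 'M_1; last first.
    by rewrite -colE !mxE.
  apply: (small_support K_infinite degP (sigma := sigma)) => L R.
  have : (row i (N n) *m map_mx sigma (pmap P L) <= N d)%MS.
    by rewrite -row_mul (submx_trans (row_sub _ _)).
  by rewrite N0 => /submx0null ->; rewrite !mul0mx.
rewrite -sub1mx submxE; apply/eqP/row_matrixP => i; rewrite row0.
rewrite row_mul; apply/rowP => j; rewrite [RHS]mxE.
have /matrixP/(_ 0 0) : row i 1%:M *m col j (cokermx (N n)) = 0 :> 'M_1; last first.
  by rewrite colE mulmxA -colE [LHS]mxE => ->; rewrite mxE.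
apply: (small_support K_infinite degP (sigma := sigma)) => L R.
have : (row i 1%:M *m map_mx sigma (pmap P L) *m map_mx sigma (pmap P R) <= N n)%MS.
  apply: submx_trans (Nst d n R); apply: submxMr; exact: submx_full.
by rewrite submxE => /eqP e; rewrite colE mulmxA e mul0mx.
Qed.

Section Minimal.
Variables (P : pfunctor K) (d : nat).

(** A degree [d] subfunctor of the [sigma]-twist, tested only at matrices over the image of [sigma];
    all twists are thus compared inside the fixed spaces $K^{\dim P(K^n)}$. *)
Definition twisted_family (sigma : {rmorphism K -> K}) (k : nat -> nat)
    (S : forall n, 'M[K]_(k n, pdim P n)) : Prop :=
  (forall m n (A : 'M_(m, n)), (S m *m map_mx sigma (pmap P A) <= S n)%MS) /\
  (forall n t, S n *m map_mx sigma (pmap P (t%:M : 'M_n)) = sigma t ^+ d *: S n).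

Variables (sigma : {rmorphism K -> K}) (k : nat -> nat).
Variable S : forall n, 'M[K]_(k n, pdim P n).
Hypothesis famS : twisted_family sigma S.
Hypothesis minS : forall (tau : {rmorphism K -> K}) j (S' : forall n, 'M_(j n, _)),
  twisted_family tau S' -> S' d != 0 -> (\rank (S d) <= \rank (S' d))%N.

Variable T : forall m n, 'M[K]_(m, n) -> 'M[K]_(pdim P m, pdim P n).
Hypothesis Tpol : forall m n i j, polf d (fun A : 'M[K]_(m, n) => T A i j).
Hypothesis TE : forall m n (A : 'M[K]_(m, n)), T (map_mx sigma A) = map_mx sigma (pmap P A).
Hypothesis T1 : forall n, T (1%:M : 'M[K]_n) = 1%:M.
Hypothesis TM : forall m n p (A : 'M[K]_(m, n)) (B : 'M_(n, p)), T (A *m B) = T A *m T B.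

Let P1 : pfunctor K := PFunctor T1 TM.

Let degP1 : degree_le d P1 := Tpol.

Lemma scalar_twist t n : (sigma t)%:M = map_mx sigma (t%:M : 'M[K]_n).
Proof. by rewrite map_scalar_mx. Qed.

Lemma family_stable m n (A : 'M_(m, n)) : (S m *m T A <= S n)%MS.
Proof.
rewrite submxE; apply/eqP/matrixP => i j; rewrite [RHS]mxE.
have pA : polf d (fun A : 'M_(m, n) => (S m *m T A *m cokermx (S n)) i j).
  exact: polf_mulmx2.
apply: (polf_dense K_infinite (sigma := sigma) pA) => B.
have [st _] := famS; have := st m n B; rewrite submxE TE => /eqP ->.
by rewrite mxE.
Qed.

Lemma family_homogeneous n t : S n *m T (t%:M : 'M_n) = t ^+ d *: S n.
Proof.
pose M e := if e == d then S n else 0.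
have ME s : \sum_(e < d.+1) s ^+ e *: M e = s ^+ d *: S n.
  rewrite (bigD1 ord_max) //= /M eqxx big1 ?addr0 // => i.
  by rewrite -val_eqE /= => /negPf ->; rewrite scaler0.
have SE e : (e < d.+1)%N -> S n *m scalar_part P1 n e = M e.
  apply: (@mx_poly_inj_on _ K_infinite sigma _ _ d.+1 (fun e => S n *m scalar_part P1 n e)).
    exact: fmorph_inj.
  move=> s; rewrite ME; have [_ <-] := famS; rewrite -TE -scalar_twist.
  rewrite (pmap_scalar K_infinite degP1 n (sigma s) : T _ = _) mulmx_sumr.
  by apply: eq_bigr => i _; rewrite scalemxAr.
rewrite (pmap_scalar K_infinite degP1 n t : T _ = _) mulmx_sumr -ME.
by apply: eq_bigr => e _; rewrite -SE // scalemxAr.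
Qed.

Let base n := row_base (S n).

Lemma base_stable m n (A : 'M_(m, n)) : (base m *m pmap P1 A <= base n)%MS.
Proof.
by rewrite !eq_row_base (submx_trans _ (family_stable A)) // submxMr ?eq_row_base.
Qed.

Definition minimal_sub : subfunctor P1 :=
  @SubFunctor _ P1 _ base (fun n => row_base_free (S n)) base_stable.

Lemma minimal_homogeneous : homogeneous minimal_sub d.
Proof.
move=> n t; have /submxP[W WE] : (base n <= S n)%MS by rewrite eq_row_base.
by rewrite /= -/(base n) WE -mulmxA family_homogeneous scalemxAr.
Qed.

(** A stable family in the [tau]-twist of the chosen subfunctor is a twisted family of [P] for
    [tau \o sigma]. Minimality over all twists makes it full at [d], and [family_support] extends
    this to every [n]. *)
Lemma minimal_stably_simple : stably_simple minimal_sub.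
Proof.
move=> tau N Nst.
have degR : degree_le d (sfunctor minimal_sub) by exact: degree_sfunctor.
have [N0 Nfull] := family_support (P := sfunctor minimal_sub) degR Nst.
have [Nd0|Ndn0] := eqVneq (N d) 0; first by left; exact: N0.
right; apply: Nfull.
have free n : row_free (map_mx tau (base n)).
  by rewrite row_free_map; exact: row_base_free.
pose S' n := N n *m map_mx tau (base n).
have fam' : twisted_family (tau \o sigma) S'.
  split=> [m n A|n t].
    rewrite map_mx_comp -TE -mulmxA -map_mxM.
    rewrite -[base m *m T _](smapE minimal_sub) map_mxM mulmxA.
    exact: submxMr.
  rewrite map_mx_comp -TE -mulmxA -map_mxM -scalar_twist.
  rewrite [base n *m T _]minimal_homogeneous map_mxZ -scalemxAr.
  by rewrite /= rmorphXn.
have rS' : \rank (S' d) = \rank (N d) by rewrite mxrankMfree // free.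
have := minS fam'; rewrite -mxrank_eq0 rS' mxrank_eq0 => /(_ Ndn0).
by rewrite -col_leq_rank.
Qed.

Lemma rank_scalar_part_twist : degree_le d P ->
  \rank (scalar_part P1 d d) = \rank (scalar_part P d d).
Proof.
move=> degP; rewrite -(mxrank_map sigma (scalar_part P d d)).
rewrite (@mx_poly_inj_on _ K_infinite sigma _ _ d.+1 (scalar_part P1 d)
  (fun e => map_mx sigma (scalar_part P d e)) _ _ d) // => [|t]; first exact: fmorph_inj.
rewrite -(pmap_scalar K_infinite degP1) /= scalar_twist TE.
rewrite (pmap_scalar K_infinite degP) rmorph_sum; apply: eq_bigr => e _.
by rewrite /= map_mxZ rmorphXn.
Qed.

End Minimal.

Theorem noetherian_polynomial_functor d (P : pfunctor K) :
  degree_le d P -> noetherian P.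
Proof.
elim: d P => [|d IHd] P degP; first exact: noetherian_degree0 degP.
have [r] := ubnP (\rank (scalar_part P d.+1 d.+1)).
elim: r P degP => [|r IHr] P degP; [by rewrite ltn0|rewrite ltnS => rP].
have [E0|En0] := eqVneq (scalar_part P d.+1 d.+1) 0.
  by apply: IHd; exact: degree_drop.
pose Q rho := exists (sigma : {rmorphism K -> K}) k (S : forall n, 'M_(k n, pdim P n)),
  [/\ twisted_family d.+1 sigma S, S d.+1 != 0 & \rank (S d.+1) = rho].
have exQ : exists rho, `[< Q rho >].
  (* The whole top-degree part, with the trivial twist, is a candidate. *)
  exists (\rank (scalar_part P d.+1 d.+1)); apply/asboolP.
  exists idfun, (pdim P), (fun n => scalar_part P n d.+1); split=> //; split=> [m n A|n t].
    by rewrite map_mx_id // (scalar_part_natural K_infinite degP) // submxMl.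
  by rewrite map_mx_id // (scalar_part_eigen K_infinite degP).
(* Minimality is taken over all twists at once, so that further twists of the
   chosen subfunctor remain simple. *)
have [rho /asboolP[sigma [k [S [famS Sn0 <-]]]] minrho] := ex_minnP exQ.
have minS (tau : {rmorphism K -> K}) j (S' : forall n, 'M_(j n, pdim P n)) :
    twisted_family d.+1 tau S' -> S' d.+1 != 0 -> (\rank (S d.+1) <= \rank (S' d.+1))%N.
  by move=> fam' S'n0; apply: minrho; apply/asboolP; exists tau, j, S'.
have [T [Tpol TE T1 TM]] := twist_exists K_infinite sigma degP.
apply: (noetherian_twist K_infinite (T1 := T1) (TM := TM) Tpol TE).
set P1 := PFunctor _ _; pose R : subfunctor P1 := minimal_sub famS Tpol TE T1 TM.
have degP1 : degree_le d.+1 P1 := Tpol.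
have homR : homogeneous R d.+1 := minimal_homogeneous famS Tpol TE T1 TM.
have simR : stably_simple R :=
  @minimal_stably_simple P d.+1 sigma k S famS minS T Tpol TE T1 TM.
have rP1 : (\rank (scalar_part P1 d.+1 d.+1) <= r)%N.
  by rewrite (rank_scalar_part_twist Tpol TE T1 TM degP).
have Rd : (0 < sdim R d.+1)%N by rewrite lt0n mxrank_eq0.
apply: (noetherian_step K_infinite (ltn0Sn d) degP1 homR simR) => [|u].
  apply: IHr; first exact: degree_quotient.
  exact: leq_trans (rank_scalar_part_quotient K_infinite degP1 homR Rd) rP1.
apply: IHr; first by apply: degree_quotient; exact: degree_shift.
have lt_shift := rank_scalar_part_quotient K_infinite (degree_shift degP1)
  (homogeneous_shift u homR) (Rd : (0 < sdim (shift_sub R u) d.+1)%N).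
exact: leq_trans lt_shift (leq_trans (rank_scalar_part_shift K_infinite _ _ degP1) rP1).
Qed.

End Noetherianity.

(** * From functors on vector spaces to functors in coordinates *)

Section Coordinates.
Variable K : fieldType.

Definition to_row (V : vectType K) (v : V) : 'rV[K]_(\dim {:V}) :=
  \row_i coord (vbasis {:V}) i v.

Definition of_row (V : vectType K) (x : 'rV[K]_(\dim {:V})) : V :=
  \sum_i x 0 i *: (vbasis {:V})`_i.

Lemma to_rowK (V : vectType K) : cancel (@to_row V) (@of_row V).
Proof.
move=> v; rewrite [RHS](coord_vbasis (memvf v)).
by apply: eq_bigr => i _; rewrite mxE.
Qed.

Lemma of_rowK (V : vectType K) : cancel (@of_row V) (@to_row V).
Proof.
move=> x; apply/rowP => i; rewrite mxE coord_sum_free //.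
exact: basis_free (vbasisP _).
Qed.

Lemma to_row_linear (V : vectType K) a (u v : V) : to_row (a *: u + v) = a *: to_row u + to_row v.
Proof. by apply/rowP => i; rewrite !mxE linearP. Qed.

Definition hom_mx (V W : vectType K) (f : 'Hom(V, W)) : 'M[K]_(\dim {:V}, \dim {:W}) :=
  \matrix_(i, j) coord (vbasis {:W}) j (f (vbasis {:V})`_i).

Lemma to_row_hom (V W : vectType K) (f : 'Hom(V, W)) v : to_row (f v) = to_row v *m hom_mx f.
Proof.
apply/rowP => j; rewrite !mxE {1}(coord_vbasis (memvf v)) !linear_sum.
by apply: eq_bigr => i _; rewrite !linearZ !mxE.
Qed.

Lemma hom_mx_eq (V W : vectType K) (f : 'Hom(V, W)) (M : 'M_(\dim {:V}, \dim {:W})) :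
  (forall v, to_row (f v) = to_row v *m M) -> hom_mx f = M.
Proof.
move=> fM; apply/row_matrixP => i; rewrite !rowE.
by rewrite -[delta_mx 0 i]of_rowK -to_row_hom fM.
Qed.

Lemma polf_meval (V : lmodType K) n (c : V -> 'I_n -> K) (p : mpoly.mpoly n K) d :
  (forall i, polf 1 (fun v => c v i)) -> (mpoly.msize p <= d.+1)%N ->
  polf d (fun v => mpoly.meval (c v) p).
Proof.
move=> pc sz; have pX i e : polf e (fun v => c v i ^+ e).
  elim: e => [|e IH]; first exact: polf_cst.
  by apply: eq_polf (polf_mul (pc i) IH) => v; rewrite exprS.
have pprod (r : seq 'I_n) (e : 'I_n -> nat) :
    polf (\sum_(i <- r) e i)%N (fun v => \prod_(i <- r) c v i ^+ e i).
  elim: r => [|i r IH].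
    by rewrite big_nil; apply: eq_polf (polf_cst _ 0 1) => v; rewrite big_nil.
  by rewrite big_cons; apply: eq_polf (polf_mul (pX i (e i)) IH) => v; rewrite big_cons.
(* The conditional coefficient makes the degree bound hold for every monomial [m], as [polf_sum]
   requires, and not only for those in the support. *)
apply: (@eq_polf _ _ _ (fun v => \sum_(m <- mpoly.msupp p)
    (if m \in mpoly.msupp p then mpoly.mcoeff m p else 0) * \prod_i c v i ^+ m i)).
  move=> v; rewrite mpoly.mevalE big_seq [RHS]big_seq.
  by apply: eq_bigr => m ->.
apply: polf_sum => m; case: ifP => [mp|_]; last first.
  by apply: eq_polf (polf_cst _ d 0) => v; rewrite mul0r.
apply: polfZ; apply: polf_le (pprod _ _).
rewrite -mpoly.mdegE -ltnS; apply: leq_trans sz.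
exact: mpoly.msize_mdeg_lt.
Qed.

Lemma polynomial_function_polf (V : vectType K) k (f : V -> K) :
  polf k f -> polynomial_function f.
Proof.
have pD (f1 f2 : V -> K) : polynomial_function f1 -> polynomial_function f2 ->
    polynomial_function (fun v => f1 v + f2 v).
  by move=> [p pE] [q qE]; exists (p + q) => v; rewrite mpoly.mevalD pE qE.
have pC c : polynomial_function (fun _ : V => c).
  by exists (mpoly.mpolyC _ c) => v; rewrite mpoly.mevalC.
have pM (f1 f2 : V -> K) : polynomial_function f1 -> polynomial_function f2 ->
    polynomial_function (fun v => f1 v * f2 v).
  by move=> [p pE] [q qE]; exists (p * q) => v; rewrite mpoly.mevalM pE qE.
elim=> {k f} [k c|k l lin|k f g _ pf _ pg|j k f g _ pf _ pg];
  [exact: (pC c)| |exact: (pD f g)|exact: (pM f g)].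
have lD u v : l (u + v) = l u + l v by rewrite -[u]scale1r lin mul1r scale1r.
have l0 : l 0 = 0 by apply: (addrI (l 0)); rewrite -lD !addr0.
have lE v : l v = \sum_(i <- index_enum 'I_(\dim {:V})) l (vbasis {:V})`_i * coordinates v i.
  rewrite {1}(coord_vbasis (memvf v)).
  have lsum I (r : seq I) F : l (\sum_(i <- r) F i) = \sum_(i <- r) l (F i).
    by elim/big_rec2: _ => // i _ y _ <-; rewrite lD.
  rewrite lsum; apply: eq_bigr => i _.
  by rewrite -[_ *: _]addr0 lin l0 addr0 mulrC.
rewrite (funext lE); elim: (index_enum _) => [|i r IH].
  by rewrite (_ : (fun v => _) = fun=> 0) //; apply/funext => v; rewrite big_nil.
rewrite (_ : (fun v => _) = fun v => l (vbasis {:V})`_i * coordinates v i +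
    \sum_(i <- r) l (vbasis {:V})`_i * coordinates v i).
  apply: pD => //; apply: pM => //.
  by exists (mpoly.mpolyX _ (mpoly.mnm1 i)) => v; rewrite mpoly.mevalXU.
by apply/funext => v; rewrite big_cons.
Qed.

Lemma polf_polynomial_function (V : vectType K) (f : V -> K) :
  polynomial_function f -> ispol (fun x => f (@of_row V x)).
Proof.
move=> [p pE]; exists (mpoly.msize p).
apply: (@eq_polf _ _ _ (fun x => mpoly.meval (coordinates (@of_row V x)) p)) => [x|].
  by rewrite pE.
apply: polf_meval => // i.
apply: (@eq_polf _ _ _ (fun x : 'rV[K]_(\dim {:V}) => x 0 i)); last exact: polf_entry.
by move=> x; rewrite -[in LHS](of_rowK x) mxE.
Qed.

Lemma polynomial_function_to_row (V : vectType K) k (g : 'rV[K]_(\dim {:V}) -> K) :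
  polf k g -> polynomial_function (fun v : V => g (to_row v)).
Proof.
by move=> pg; apply: (@polynomial_function_polf V k); apply: polf_comp pg => a u v;
  rewrite to_row_linear.
Qed.

End Coordinates.

Section FunctorMatrices.
Variables (K : fieldType) (P : vec_functor K).

Definition fdim n := \dim {:P 'cV[K]_n}.

(** The transpose translates between rows acted on from the right and columns acted on from the
    left. *)
Definition fmap m n (A : 'M[K]_(m, n)) : 'M[K]_(fdim m, fdim n) :=
  hom_mx (fmor P (linfun (mulmx A^T) : 'Hom('cV_m, 'cV_n))).

Lemma fmap1 n : fmap (1%:M : 'M_n) = 1%:M.
Proof.
apply: hom_mx_eq => v; rewrite mulmx1 trmx1.
have -> : linfun (mulmx 1%:M) = \1%VF :> 'Hom('cV[K]_n, 'cV_n).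
  by apply/lfunP => w; rewrite !lfunE /= mul1mx.
by rewrite fmor_id id_lfunE.
Qed.

Lemma fmapM m n p (A : 'M_(m, n)) (B : 'M_(n, p)) : fmap (A *m B) = fmap A *m fmap B.
Proof.
apply: hom_mx_eq => v; rewrite mulmxA -!to_row_hom -comp_lfunE -fmor_comp.
congr (to_row (fmor P _ v)); apply/lfunP => w.
by rewrite comp_lfunE !lfunE /= trmx_mul mulmxA.
Qed.

Definition functor_of : pfunctor K := PFunctor fmap1 fmapM.

Lemma degree_functor_of d :
  (forall V W : vectType K, polynomial_map_le d (@fmor K P V W)) -> degree_le d functor_of.
Proof.
move=> Pd m n i j; pose U : vectType K := 'Hom(P 'cV[K]_m, P 'cV[K]_n).
have [p pE] := choice (Pd 'cV_m 'cV_n).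
pose L (A : 'M_(m, n)) : 'Hom('cV[K]_m, 'cV[K]_n) := linfun (mulmx A^T).
have pf : polf d (fun A : 'M[K]_(m, n) => \sum_(l < \dim {:U})
    coord (vbasis {:P 'cV[K]_n}) j ((vbasis {:U})`_l (vbasis {:P 'cV[K]_m})`_i) *
    mpoly.meval (coordinates (L A)) (p l)).
  apply: polf_sum => l; apply: polfZ; have [sz _] := pE l.
  apply: polf_meval sz => q; apply: polf_lin => a A B.
  rewrite /coordinates -linearP; congr (coord _ _ _); apply/lfunP => v.
  by rewrite !(add_lfunE, scale_lfunE) !lfunE /= linearP mulmxDl scalemxAl.
apply: eq_polf pf => A.
rewrite /= mxE [in RHS](coord_vbasis (memvf (fmor P _))) sum_lfunE linear_sum.
apply: eq_bigr => l _; rewrite scale_lfunE linearZ mulrC.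
by have [_ <-] := pE l.
Qed.

End FunctorMatrices.

Section GLDensity.
Variable K : fieldType.
Hypothesis K_infinite : infinite_set [set: K].

(** On the line from [G] to the identity the determinant is a nonzero polynomial, and its product
    with [phi] vanishes. *)
Lemma polf_GL_dense n k (phi : 'M[K]_n -> K) : polf k phi ->
  (forall G, G \in unitmx -> phi G = 0) -> forall G, phi G = 0.
Proof.
move=> pphi phi0 G.
have [kd pdet] : ispol (fun A : 'M[K]_n => \det A).
  by apply: ispol_det => i j; exists 1%N; exact: polf_entry.
pose q := taylor phi G (1%:M - G); pose delta := taylor (fun A => \det A) G (1%:M - G).
have qdelta : q * delta = 0.
  apply: poly_fun0 => // t; rewrite hornerM -(taylorE pphi) -(taylorE pdet).
  have [unit|] := boolP (G + t *: (1%:M - G) \in unitmx); first by rewrite phi0 ?mul0r.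
  by rewrite unitmxE unitfE negbK => /eqP ->; rewrite mulr0.
have delta_n0 : delta != 0.
  apply/eqP => d0; have := taylorE pdet G (1%:M - G) 1.
  rewrite -/delta d0 horner0 scale1r addrC subrK det1 => /eqP.
  by rewrite oner_eq0.
move/eqP: qdelta; rewrite mulf_eq0 (negPf delta_n0) orbF => /eqP q0.
by rewrite -(taylor0 pphi G (1%:M - G)) -/q q0 coef0.
Qed.

Variable P : vec_functor K.

Definition level (x : P_infty P) n : 'rV[K]_(fdim P n) := to_row (component n x).

Lemma to_row_fmor m n (A : 'M[K]_(m, n)) v :
  to_row (fmor P (linfun (mulmx A^T)) v) = to_row v *m fmap P A.
Proof. exact: to_row_hom. Qed.

Lemma truncate_pid m n (le_mn : (m <= n)%N) :
  truncate K le_mn = linfun (mulmx (pid_mx m : 'M[K]_(n, m))^T).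
Proof.
apply/lfunP => v; apply/colP => i; rewrite truncateE lfunE /= tr_pid_mx mxE.
rewrite (bigD1 (widen_ord le_mn i)) //= mxE /= eqxx ltn_ord mul1r big1 ?addr0 // => j.
by rewrite -val_eqE /= mxE eq_sym => /negPf ->; rewrite mul0r.
Qed.

Lemma level_truncate m n (le_mn : (m <= n)%N) x :
  level x m = level x n *m fmap P (pid_mx m).
Proof. by rewrite /level -to_row_fmor -truncate_pid component_truncate. Qed.

Lemma mx_hom_tr n (g : 'M[K]_n) : mx_hom g = linfun (mulmx (g^T)^T).
Proof. by rewrite trmxK. Qed.

Lemma component_GL_act n (g : 'M[K]_n) (x : P_infty P) m :
  component m (GL_act g x) = GL_act_fun g x m.
Proof. by rewrite /component ?set_valE. Qed.

Lemma level_GL_act n (g : 'M[K]_n) m :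
  exists N (A : 'M_(N, m)), forall x, level (GL_act g x) m = level x N *m fmap P A.
Proof.
exists (n + m)%N, ((block_mx g 0 0 1%:M)^T *m pid_mx m) => x.
rewrite /level component_GL_act /GL_act_fun truncate_pid to_row_fmor mx_hom_tr to_row_fmor.
by rewrite -mulmxA -fmapM.
Qed.

Lemma level_GL_act_le n (g : 'M[K]_n) m (x : P_infty P) : (m <= n)%N ->
  level (GL_act g x) m = level x n *m fmap P (g^T *m pid_mx m).
Proof.
move=> le_mn; rewrite /level component_GL_act /GL_act_fun.
rewrite -(truncate_comp K le_mn (leq_addr m n) (leq_addl n m)) fmor_comp comp_lfunE.
have -> : fmor P (truncate K (leq_addr m n))
    (fmor P (mx_hom (block_mx g 0 0 1%:M)) (component (n + m) x)) =
    fmor P (mx_hom g) (component n x).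
  rewrite -(component_truncate (leq_addr m n) x) -!comp_lfunE -!fmor_comp.
  congr (fmor P _ _); apply/lfunP => v; rewrite !comp_lfunE !mx_homE.
  have truncE (w : 'cV_(n + m)) : truncate K (leq_addr m n) w = usubmx w.
    apply/colP => i; rewrite truncateE mxE; congr (w _ _); exact: val_inj.
  rewrite !truncE -[v in LHS]vsubmxK mul_block_col mul0mx addr0.
  by rewrite col_mxKu.
by rewrite truncate_pid to_row_fmor mx_hom_tr to_row_fmor -mulmxA -fmapM.
Qed.

(** The passage from [GL] to all matrices: with [M = N + p], any [A] is a corner of a square matrix
    of size [M], to which vanishing extends from the invertible ones by density. *)
Lemma GL_orbit_zero d p k (f : 'rV[K]_(fdim P p) -> K) x :
  degree_le d (functor_of P) -> polf k f ->
  (forall N (G : 'M_N), G \in unitmx -> f (level (GL_act G x) p) = 0) ->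
  forall N (A : 'M_(N, p)), f (level x N *m fmap P A) = 0.
Proof.
move=> degP pf f0 N A; pose M := (N + p)%N.
have pM : (p <= M)%N by rewrite leq_addl.
have NM : (N <= M)%N by rewrite leq_addr.
have [kphi pphi] : ispol (fun G : 'M[K]_M => f (level x M *m fmap P (G *m pid_mx p))).
  apply: (ispol_comp_row pf) => j; apply: ispol_mulmx => [a b|a b]; first exact: ispol_cst.
  exists d; apply: (polf_comp (f := fun G : 'M[K]_(M, p) => fmap P G a b)
    (L := mulmxr (pid_mx p))); last exact: degP.
  by move=> c u v; rewrite linearP.
have phi0 := polf_GL_dense pphi _ (pid_mx N *m A *m pid_mx p).
rewrite (level_truncate NM) -mulmxA -fmapM.
suff -> : (pid_mx N : 'M_(M, N)) *m A = pid_mx N *m A *m pid_mx p *m (pid_mx p : 'M_(M, p)).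
  apply: phi0 => G Gu; rewrite -[G]trmxK -level_GL_act_le //.
  by apply: f0; rewrite unitmx_tr.
by rewrite -[RHS]mulmxA mul_pid_mx minnn (minn_idPr pM) pid_mx_1 mulmx1.
Qed.

(** * Closed stable subsets of the inverse limit *)

Section StableSets.
Variable d : nat.
Hypothesis degP : degree_le d (functor_of P).

Definition level_image (Y : set (P_infty P)) n : set 'rV[K]_(pdim (functor_of P) n) :=
  [set level x n | x in Y].

Lemma level_image_stable (Y : set (P_infty P)) : GL_stable Y ->
  forall m n (A : 'M_(m, n)) x, level_image Y x ->
  cl (@level_image Y n) (x *m pmap (functor_of P) A).
Proof.
move=> Yst m n A _ [x Yx <-] k f pf f0.
apply: (GL_orbit_zero degP pf) => N G Gu; apply: f0.
by exists (GL_act G x) => //; exact: Yst.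
Qed.

End StableSets.

Lemma zariski_open_preim (V W : vectType K) (L : 'Hom(V, W)) (O : set W) :
  @zariski_open K W O -> @zariski_open K V [set v | O (L v)].
Proof.
move=> [S Spol SE]; exists [set g | exists2 f, S f & g = f \o L].
  move=> _ [f /Spol/polf_polynomial_function[k pf] ->].
  apply: (@polynomial_function_polf _ _ k).
  apply: (@eq_polf _ _ _ (fun v => f (of_row (to_row (L v))))) => [v|]; first by rewrite to_rowK.
  by apply: (polf_comp (L := fun v => to_row (L v))) pf => a u v; rewrite linearP to_row_linear.
apply/seteqP; split=> v /= Ov.
  move=> _ [f Sf ->] /=; have : (~` O) (L v) by [].
  by rewrite SE; apply.
have : (~` O) (L v) by rewrite SE => f Sf; apply: (Ov (f \o L)); exists f.
by [].
Qed.

(** Its convergence to [x] says that Zariski open sets pulled back from a single level form a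
    neighbourhood basis on the limit; finitely many levels are merged by truncation from a common
    larger one. *)
Definition level_filter (x : P_infty P) :
    set_system (prod_topology (fun n : nat => zariski (P 'cV[K]_n))) :=
  [set U | exists n (O : set (P 'cV[K]_n)), [/\ @zariski_open K _ O, O (component n x) &
    forall y : P_infty P, O (component n y) -> U (set_val y)]].

Lemma level_filter_filter x : Filter (level_filter x).
Proof.
split=> [|U V [n [O [Oo Ox OU]]] [m [O' [Oo' Ox' OV]]]|U V UV [n [O [Oo Ox OU]]]].
- by exists 0%N, setT; split=> //; exact: zariski_openT.
- have ln : (n <= n + m)%N by rewrite leq_addr.
  have lm : (m <= n + m)%N by rewrite leq_addl.
  exists (n + m)%N, ([set v | O (fmor P (truncate K ln) v)] `&`
                     [set v | O' (fmor P (truncate K lm) v)]).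
  split; first by apply: zariski_openI; exact: zariski_open_preim.
    by split; rewrite /= component_truncate.
  by move=> y []; rewrite /= !component_truncate => /OU ? /OV.
- by exists n, O; split=> // y /OU /UV.
Qed.

Lemma level_filter_cvg x : level_filter x --> (set_val x :
  prod_topology (fun n : nat => zariski (P 'cV[K]_n))).
Proof.
have := level_filter_filter x => F; apply/cvg_sup => n U.
rewrite nbhsE => -[_ [[O Oo <-] Ox] OU]; exists n, O; split=> // y Oy.
exact: OU.
Qed.

Lemma closed_separation (Y : set (P_infty P)) x : closed Y -> ~ Y x ->
  exists n (f : P 'cV[K]_n -> K),
    [/\ polynomial_function f, forall y, Y y -> f (component n y) = 0 &
        f (component n x) != 0].
Proof.
move=> Yc nYx; have : open (~` Y) by rewrite openC.
move=> [U Uo UE]; have Ux : U (set_val x) by have : (~` Y) x by []; rewrite -UE.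
have [n [O [[S Spol SE] Ox OU]]] := level_filter_cvg (open_nbhs_nbhs (conj Uo Ux)).
have : ~ zero_locus S (component n x) by rewrite -SE /= => /(_ Ox).
move=> /existsNP[f /not_implyP[Sf /eqP fx]]; exists n, f; split=> //; first exact: Spol.
move=> y Yy; have : zero_locus S (component n y); last by apply.
rewrite -SE => /OU Uy; have : (~` Y) y by rewrite -UE.
exact.
Qed.

Lemma closed_equation (F : P_infty P -> K) : polynomial_equation F -> closed [set x | F x = 0].
Proof.
move=> [n [f pf ->]].
have : closed ([set v | f v = 0] : set (zariski (P 'cV[K]_n))).
  apply/closed_zariskiE; exists [set f]; first by move=> _ ->.
  by apply/seteqP; split=> v /= => [fv _ ->|]; [|apply].
apply: (@closed_comp _ _ (fun x : P_infty P => (component n x : zariski _))) => x _.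
apply: (@continuous_comp _ _ _ set_val
  (fun y : prod_topology (fun n : nat => zariski (P 'cV[K]_n)) => y n)).
  exact: initial_continuous.
exact: proj_continuous.
Qed.

End GLDensity.

(** * Chains and equations in the inverse limit *)

Section Corollary.
Variable K : fieldType.
Hypothesis K_infinite : infinite_set [set: K].
Variables (P : vec_functor K) (d : nat).
Hypothesis degP : degree_le d (functor_of P).

Record stable_closed := StableClosed {
  sc_set :> set (P_infty P);
  sc_closed : closed sc_set;
  sc_stable : GL_stable sc_set
}.

Definition sc_le (Y Z : stable_closed) : Prop := sc_set Y `<=` sc_set Z.

(** A closed subset of the limit is cut out by equations from single levels, so the closures of its
    level images determine it. *)
Lemma stable_closed_wf : well_founded (strict sc_le).
Proof.
pose phi (Y : stable_closed) := closure_sub (level_image_stable K_infinite degP (@sc_stable Y)).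
apply: (strict_pullback (phi := phi) _ _ (noetherian_polynomial_functor K_infinite degP)).
  by move=> Y Z YZ n; apply: cl_mono => _ [x Yx <-]; exists x => //; exact: YZ.
move=> Y Z YZ ZY x Zx; apply: contrapT => nYx.
have [n [f [/polf_polynomial_function[k pf] fY /eqP]]] := closed_separation (@sc_closed Y) nYx.
apply; rewrite -(to_rowK (component n x)).
apply: (ZY n (level x n) _ k _ pf); first by apply: sub_cl; exists x.
by move=> _ [y Yy <-]; rewrite /level to_rowK; exact: fY.
Qed.

Lemma equation_level (F : P_infty P -> K) : polynomial_equation F ->
  exists p k (f : 'rV[K]_(fdim P p) -> K), polf k f /\ forall x, F x = f (level x p).
Proof.
move=> [p [f /polf_polynomial_function[k pf] ->]].
by exists p, k, (f \o @of_row K (P 'cV[K]_p)); split=> // x /=; rewrite /level to_rowK.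
Qed.

Lemma equation_GL_act (F : P_infty P -> K) n (g : 'M[K]_n) :
  polynomial_equation F -> polynomial_equation (F \o GL_act g).
Proof.
move=> /equation_level[p [k [f [pf FE]]]]; have [N [A AE]] := level_GL_act P g p.
exists N, (fun v => f (to_row v *m fmap P A)).
  by apply: (@polynomial_function_to_row _ _ k (fun w => f (w *m fmap P A))); exact: polf_mulmxr.
by apply/funext => x /=; rewrite FE AE.
Qed.

Lemma GL_act1 n (x : P_infty P) : component n (GL_act (1%:M : 'M_n) x) = component n x.
Proof.
apply: (can_inj (@to_rowK K _)); have := level_GL_act_le (1%:M : 'M_n) x (leqnn n).
by rewrite trmx1 mul1mx pid_mx_1 fmap1 mulmx1.
Qed.

Section CommonZeroes.
Variables (k : nat) (F : 'I_k -> P_infty P -> K).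
Hypothesis eqF : forall i, polynomial_equation (F i).

Local Notation Z := (common_zeroes (\bigcup_i GL_orbit (F i))).

Lemma common_zeroesP x :
  Z x <-> forall i n (g : 'M_n), g \in unitmx -> F i (GL_act g x) = 0.
Proof.
split=> [Zx i n g gu|Fx G [i _ [n [g gu ->]]]]; last first.
  by have := Fx i n (invmx g); rewrite unitmx_inv; apply.
apply: (Zx (F i \o GL_act g)); exists i => //; exists n, (invmx g).
  by rewrite unitmx_inv.
by rewrite /GL_act_equation invmxK.
Qed.

Lemma common_zeroes_closed : closed Z.
Proof.
have -> : Z = \bigcap_(G in \bigcup_i GL_orbit (F i)) [set x | G x = 0].
  by apply/seteqP; split=> x Zx G; exact: Zx.
apply: closed_bigI => G [i _ [n [g _ ->]]].
by apply: closed_equation; exact: equation_GL_act.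
Qed.

(** Rather than composing two actions of different sizes into one, the vanishing on a [GL]-orbit is
    extended to all matrices, among them the product [A' *m A]. *)
Lemma common_zeroes_stable : GL_stable Z.
Proof.
move=> n g _ x /common_zeroesP Zx; apply/common_zeroesP => i m h _.
have [p [k' [f [pf FE]]]] := equation_level (eqF i).
have [N [A AE]] := level_GL_act P h p; have [N' [A' AE']] := level_GL_act P g N.
rewrite FE AE AE' -mulmxA -fmapM; apply: (GL_orbit_zero K_infinite degP pf) => M G Gu.
by rewrite -FE; exact: Zx.
Qed.

Definition common_zeroes_sc : stable_closed :=
  StableClosed common_zeroes_closed common_zeroes_stable.

End CommonZeroes.

(** Well-founded induction on the common zero set [W] of the orbits chosen so far, starting from
    none: while [W] exceeds [Y], an equation separating a point of [W] from [Y] is added, and the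
    identity matrix shows that this point leaves [W]. *)
Lemma finite_equations (Y : set (P_infty P)) : closed Y -> GL_stable Y ->
  exists (k : nat) (F : 'I_k -> P_infty P -> K),
    (forall i, polynomial_equation (F i)) /\
    Y = common_zeroes (\bigcup_i GL_orbit (F i)).
Proof.
move=> Yc Yst.
suff H (W : stable_closed) : forall k (F : 'I_k -> P_infty P -> K)
    (eqF : forall i, polynomial_equation (F i)),
    (forall i y, Y y -> F i y = 0) -> W = common_zeroes_sc eqF ->
    exists (k : nat) (F : 'I_k -> P_infty P -> K),
    (forall i, polynomial_equation (F i)) /\
    Y = common_zeroes (\bigcup_i GL_orbit (F i)).
  have F0 (i : 'I_0) : polynomial_equation ((fun=> fun=> 0) i : P_infty P -> K) by case: i.
  by apply: (H _ 0%N _ F0) => //; case.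
elim: W / (stable_closed_wf W) => W _ IH k F eqF FY WE.
have YW : Y `<=` W.
  move=> y Yy; rewrite WE; apply/common_zeroesP => i n g gu.
  by apply: FY; exact: Yst.
have [WY|/existsNP[x /not_implyP[Wx nYx]]] := pselect (W `<=` Y).
  exists k, F; split=> //; rewrite -[RHS]/(sc_set (common_zeroes_sc eqF)) -WE.
  exact/seteqP.
have [n [f [pf fY fx]]] := closed_separation Yc nYx.
pose F' (i : 'I_k.+1) := if unlift ord0 i is Some j then F j else f \o component n.
have eqF' i : polynomial_equation (F' i).
  by rewrite /F'; case: unlift => [j|]; [exact: eqF|exists n, f].
have F'Y i y : Y y -> F' i y = 0.
  by rewrite /F'; case: unlift => [j|]; [exact: FY|exact: fY].
apply: (IH (common_zeroes_sc eqF') _ _ F' eqF' F'Y erefl).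
split=> [y /common_zeroesP F'y|WF'].
  rewrite /sc_le WE; apply/common_zeroesP => i m g gu.
  by have := F'y (lift ord0 i) m g gu; rewrite /F' liftK.
have /common_zeroesP/(_ ord0 n 1%:M (unitmx1 _ _)) := WF' x Wx.
by rewrite /F' unlift_none /= GL_act1 => /eqP; rewrite (negPf fx).
Qed.

Lemma chain_stable : GL_noetherian P.
Proof.
move=> Y Yc Yst Ydec; pose S i := StableClosed (Yc i) (@Yst i).
have [||N NP] := strict_chain_stable (le := sc_le) (Y := S) _ _ stable_closed_wf Ydec.
- by move=> W x.
- by move=> W1 W2 W3 W12 W23 x /W12 /W23.
exists N => i Ni; apply/seteqP; split; last exact: NP.
by rewrite -(subnKC Ni); elim: (i - N)%N => [|j IHj]; rewrite ?addn0 // addnS => x /Ydec /IHj.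
Qed.

End Corollary.

Theorem corollary3 (K : fieldType) (K_infinite : infinite_set [set: K])
    (P : vec_functor K) (P_poly : finite_degree_polynomial P) :
  GL_noetherian P /\
  (forall Y : set (P_infty P), closed Y -> GL_stable Y ->
     exists (k : nat) (F : 'I_k -> P_infty P -> K),
       (forall i, polynomial_equation (F i)) /\
       Y = common_zeroes (\bigcup_i GL_orbit (F i))).
Proof.
have [d /degree_functor_of degP] := P_poly.
by split; [exact: (chain_stable K_infinite degP)|exact: (finite_equations K_infinite degP)].
Qed.
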